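(* Let $\Bbbk$ be a commutative ring, let $F$ be an analytic functor from $\mathbf{gr}^{op}$ to $\Bbbk$-modules and let $G$ be an arbitrary functor from $\mathbf{gr}$ to $\Bbbk$-modules. Then the morphism $$\mathrm{Tor}_*^{\mathbf{S}_c(\mathbf{gr})}(\beta^*G,\beta^*F)\to \mathrm{Tor}_*^{\mathbf{gr}}(F,G)$$ induced by the functor $\beta:\mathbf{S}_c(\mathbf{gr})\to\mathbf{gr}^{op}$ is an isomorphism.
   Context: $\mathbf{gr}$ is the full subcategory of the category of groups whose objects are the free groups $\mathbb{Z}^{*n}$, $n\in\mathbb{N}$; $*$ is the free product. $\mathbf{S}_c(\mathbf{gr})$ is the category with the same objects as $\mathbf{gr}$, a morphism $G\to H$ being a pair $(u,v)$ of group morphisms $u:G\to H$, $v:H\to G$ for which there exist an object $T$ of $\mathbf{gr}$ and an isomorphism $\phi:H\simeq G*T$ such that $\phi\circ u$ is the canonical inclusion $G\to G*T$ and $v$ is the composite of $\phi$ with the canonical projection $G*T\to G$ (killing $T$). Composition is $(f,g)\circ(f',g')=(f\circ f',g'\circ g)$. The functor $\beta:\mathbf{S}_c(\mathbf{gr})\to\mathbf{gr}^{op}$ is the identity on objects and sends $(u,v)$ to $v$. Here $\beta^*F=F\circ\beta$ is a covariant functor on $\mathbf{S}_c(\mathbf{gr})$ and $\beta^*G=G\circ\beta^{op}$ is a contravariant functor on $\mathbf{S}_c(\mathbf{gr})$. For a small category $\mathcal{C}$, and functors $A:\mathcal{C}^{op}\to\Bbbk\text{-}\mathrm{Mod}$,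 $B:\mathcal{C}\to\Bbbk\text{-}\mathrm{Mod}$, $A\otimes_\mathcal{C}B$ is the coend of $A\otimes_\Bbbk B$, and $\mathrm{Tor}^\mathcal{C}_*(A,B)$ are the left derived functors of this balanced bifunctor; there is a canonical isomorphism $\mathrm{Tor}^{\mathcal{C}^{op}}_*(B,A)\simeq\mathrm{Tor}^{\mathcal{C}}_*(A,B)$. A functor $\varphi:\mathcal{C}\to\mathcal{D}$ induces a natural morphism $\mathrm{Tor}^\mathcal{C}_*(\varphi^*A,\varphi^*B)\to\mathrm{Tor}^\mathcal{D}_*(A,B)$. A functor $F:\mathbf{gr}^{op}\to\Bbbk\text{-}\mathrm{Mod}$ is polynomial of degree at most $d$ if for all objects $a_1,\dots,a_{d+1}$ the kernel of $F(a_1*\dots*a_{d+1})\to\bigoplus_{i}F(a_1*\dots*\widehat{a_i}*\dots*a_{d+1})$ (induced by the inclusions omitting one factor) is zero; $F$ is analytic if it is isomorphic to a colimit (which may be assumed filtered) of polynomial functors. *)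

(* Defs.v *)
From HB Require Import structures.
From mathcomp Require Import all_boot all_order all_algebra boolp.

Set Implicit Arguments.
Unset Strict Implicit.
Unset Printing Implicit Defensive.

Import GRing.Theory.
Local Open Scope ring_scope.
Local Open Scope quotient_scope.

(** * Free groups *)

Section FreeGroup.
Variable X : choiceType.
Implicit Types (a b : X * bool) (u v w : seq (X * bool)).

(* The letter (x, false) stands for x and (x, true) for its inverse. *)
Definition linv a : X * bool := (a.1, ~~ a.2).

Definition reduced w := sorted (fun a b => b != linv a) w.

Record free_group := FreeWord { word :> seq (X * bool); _ : reduced word }.
HB.instance Definition _ := [isSub for word].
HB.instance Definition _ := [Choice of free_group by <:].

Definition lmulw a w :=
  if w is b :: w' then if b == linv a then w' else a :: w else [:: a].

Lemma linvK : involutive linv.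
Proof. by case=> x b; rewrite /linv /= negbK. Qed.

Lemma lmulw_reduced a w : reduced w -> reduced (lmulw a w).
Proof.
case: w => [//|b w] /= rw; case: eqP => [_|/eqP ab]; first exact: path_sorted rw.
by rewrite /= ab.
Qed.

Lemma lmulwK a w : reduced w -> lmulw a (lmulw (linv a) w) = w.
Proof.
case: w => [|b w] /= rw; first by rewrite eqxx.
rewrite linvK; case: eqP rw => [->|_ _ /=]; last by rewrite eqxx.
by case: w => [//|c w] /= /andP[/negPf->].
Qed.

Definition mulw u v := foldr lmulw v u.

Lemma mulw_reduced u v : reduced v -> reduced (mulw u v).
Proof. by move=> rv; elim: u => //= a u; apply: lmulw_reduced. Qed.

Lemma mulw_lmulw a u v : reduced v -> mulw (lmulw a u) v = lmulw a (mulw u v).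
Proof.
move=> rv; case: u => [//|b u] /=; case: eqP => [->|//].
by rewrite lmulwK// mulw_reduced.
Qed.

Lemma mulwA u v w : reduced w -> mulw u (mulw v w) = mulw (mulw u v) w.
Proof. by move=> rw; elim: u => //= a u ->; rewrite mulw_lmulw. Qed.

Lemma mulw1 w : reduced w -> mulw w [::] = w.
Proof.
elim: w => //= a w IHw rw; rewrite {}IHw; last exact: path_sorted rw.
by case: w rw => //= b w /andP[/negPf->].
Qed.

Definition invw w := rev (map linv w).

Lemma invw_reduced w : reduced w -> reduced (invw w).
Proof.
rewrite /reduced /invw rev_sorted sorted_map.
by apply: sub_sorted => a b /=; rewrite linvK eq_sym.
Qed.

Lemma mulVw w v : reduced v -> mulw (invw w) (mulw w v) = v.
Proof.
move=> rv; elim: w => //= a w IHw; rewrite /invw /= rev_cons /mulw foldr_rcons.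
have := lmulwK (linv a) (mulw_reduced w rv).
by rewrite linvK /mulw => ->.
Qed.

Lemma invwK : involutive invw.
Proof. by move=> w; rewrite /invw map_rev revK mapK//; apply: linvK. Qed.

Definition fg1 : free_group := @FreeWord [::] isT.
Definition fgM (u v : free_group) : free_group :=
  FreeWord (mulw_reduced u (valP v)).
Definition fgV (u : free_group) : free_group := FreeWord (invw_reduced (valP u)).

Lemma fgMA : associative fgM.
Proof. by move=> u v w; apply: val_inj; rewrite /= mulwA//; apply: (valP w). Qed.
Lemma fg1M : left_id fg1 fgM.
Proof. by move=> u; apply: val_inj. Qed.
Lemma fgM1 : right_id fg1 fgM.
Proof. by move=> u; apply: val_inj; rewrite /= mulw1//; apply: (valP u). Qed.
Lemma fgVM : left_inverse fg1 fgV fgM.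
Proof.
move=> u; apply: val_inj => /=.
by rewrite -[X in mulw _ X]mulw1 ?(valP u)// mulVw.
Qed.
Lemma fgMV : right_inverse fg1 fgV fgM.
Proof.
move=> u; apply: val_inj => /=.
by rewrite -{1}[val u]invwK -[X in mulw _ X]mulw1 ?mulVw ?invw_reduced ?(valP u).
Qed.

HB.instance Definition _ := isGroup.Build free_group fgMA fg1M fgM1 fgVM fgMV.

Definition gen (x : X) : free_group := @FreeWord [:: (x, false)] isT.

Section Lift.
Variables (H : groupType) (f : X -> H).

Definition letter_val a : H := (if a.2 then (f a.1)^-1 else f a.1)%g.
Definition free_lift (w : free_group) : H := (\prod_(a <- val w) letter_val a)%g.

Fact free_lift1 : free_lift 1%g = 1%g.
Proof. by rewrite /free_lift big_nil. Qed.

Lemma letter_valV a : letter_val (linv a) = (letter_val a)^-1%g.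
Proof. by case: a => x [] //=; rewrite /letter_val /= invgK. Qed.

Fact free_liftM : {morph free_lift : u v / (u * v)%g}.
Proof.
move=> [u ru] v; rewrite /free_lift /=.
elim: u {ru} => [|a u IHu] /=; first by rewrite big_nil mul1g.
rewrite big_cons -mulgA -IHu; case: (mulw u (val v)) => [|b w] /=.
  by rewrite big_cons.
case: eqP => [->|_]; rewrite !big_cons// letter_valV mulgA mulgV.
by rewrite mul1g.
Qed.

HB.instance Definition _ := isMultiplicative.Build _ _ free_lift free_liftM.
HB.instance Definition _ :=
  Multiplicative_isUMagmaMorphism.Build _ _ free_lift free_lift1.

Lemma free_lift_gen x : free_lift (gen x) = f x.
Proof. by rewrite /free_lift big_seq1. Qed.

End Lift.

Lemma free_group_ext (H : groupType) (f g : UMagmaMorphism.type free_group H) :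
  (forall x, f (gen x) = g (gen x)) -> f =1 g.
Proof.
move=> fg [w rw]; elim: w rw => [|[x b] w IHw] rw.
  suff -> : FreeWord rw = 1%g by rewrite !gmulf1.
  exact: val_inj.
have rw' := path_sorted rw.
suff -> : FreeWord rw = ((if b then (gen x)^-1 else gen x) * FreeWord rw')%g.
  by rewrite !gmulfM IHw; case: b {rw}; rewrite ?gmulfV fg.
apply: val_inj; case: b rw => /= rw; case: (w) rw => [//|c w0] /= /andP[/negPf h _];
  by rewrite /linv /= in h *; rewrite h.
Qed.

End FreeGroup.

Lemma monoid_morphism_eq (G H : groupType) (f g : UMagmaMorphism.type G H) :
  f =1 g -> f = g.
Proof.
move: f g => [f [[m1] [m2]]] [g [[m1'] [m2']]] /= /funext fg.
move: m1 m2 m1' m2'; rewrite {}fg => m1 m2 m1' m2'.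
by rewrite (Prop_irrelevance m1 m1') (Prop_irrelevance m2 m2').
Qed.

(** * Categories *)

(* Associativity is recorded in both directions, and the record has eta, so that
   [op (op C)] and [C] are convertible. *)
#[local] Set Primitive Projections.
Record category := Category {
  obj :> Type;
  hom : obj -> obj -> Type;
  idm : forall x, hom x x;
  comp : forall x y z, hom y z -> hom x y -> hom x z;
  comp1m : forall x y (f : hom x y), comp (idm y) f = f;
  compm1 : forall x y (f : hom x y), comp f (idm x) = f;
  compA : forall x y z t (f : hom z t) (g : hom y z) (h : hom x y),
    comp f (comp g h) = comp (comp f g) h;
  compA' : forall x y z t (f : hom z t) (g : hom y z) (h : hom x y),
    comp (comp f g) h = comp f (comp g h)
}.
#[local] Unset Primitive Projections.
Arguments idm {C} x : rename.
Arguments comp {C x y z} f g : rename.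

Definition op (C : category) : category :=
  {| obj := obj C;
     hom := fun x y => hom y x;
     idm := @idm C;
     comp := fun x y z f g => comp g f;
     comp1m := fun x y => @compm1 C y x;
     compm1 := fun x y => @comp1m C y x;
     compA := fun x y z t f g h => @compA' C t z y x h g f;
     compA' := fun x y z t f g h => @compA C t z y x h g f |}.

Record functor (C D : category) := Functor {
  fob :> C -> D;
  fmap : forall x y, hom x y -> hom (fob x) (fob y);
  fmap1 : forall x, fmap (idm x) = idm (fob x);
  fmapM : forall x y z (f : hom y z) (g : hom x y),
    fmap (comp f g) = comp (fmap f) (fmap g)
}.

Definition opF C D (phi : functor C D) : functor (op C) (op D) :=
  {| fob := phi : op C -> op D;
     fmap := fun x y (f : @hom (op C) x y) => fmap phi f;
     fmap1 := fmap1 phi;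
     fmapM := fun x y z f g => fmapM phi g f |}.

(** * The categories gr and S_c(gr) *)

(* The object n is the free group on n generators. *)
Definition Fr (n : nat) := free_group 'I_n.

Definition grhom (m n : nat) := UMagmaMorphism.type (Fr m) (Fr n).

Definition grcomp m n p (f : grhom n p) (g : grhom m n) : grhom m p := f \o g.

Lemma grcompA m n p q (f : grhom p q) (g : grhom n p) (h : grhom m n) :
  grcomp f (grcomp g h) = grcomp (grcomp f g) h.
Proof. exact: monoid_morphism_eq. Qed.

Lemma grcomp1m m n (f : grhom m n) : grcomp idfun f = f.
Proof. exact: monoid_morphism_eq. Qed.

Lemma grcompm1 m n (f : grhom m n) : grcomp f idfun = f.
Proof. exact: monoid_morphism_eq. Qed.

Definition gr : category :=
  {| obj := nat;
     hom := grhom;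
     idm := fun n => idfun : grhom n n;
     comp := grcomp;
     comp1m := grcomp1m;
     compm1 := grcompm1;
     compA := grcompA;
     compA' := fun m n p q f g h => esym (grcompA f g h) |}.

(* The free product of the objects m and n is m + n: its first m generators are
   those of m and the last n ones are those of n. *)
Definition gr_inl m n : grhom m (m + n) := free_lift (fun i => gen (lshift n i)).
Definition gr_inr m n : grhom n (m + n) := free_lift (fun i => gen (rshift m i)).
Definition gr_copair m n p (f : grhom m p) (g : grhom n p) : grhom (m + n) p :=
  free_lift (fun i => match split i with
                      | inl j => f (gen j)
                      | inr j => g (gen j)
                      end).
Definition gr_triv m n : grhom m n := free_lift (fun=> 1%g).
(* The projection of m * n onto m killing n. *)
Definition gr_proj m n : grhom (m + n) m := gr_copair idfun (gr_triv n m).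

Lemma grhom_ext m n (f g : grhom m n) :
  (forall i, f (gen i) = g (gen i)) -> f = g.
Proof. by move=> fg; apply/monoid_morphism_eq/free_group_ext. Qed.

Lemma gr_copair_inl m n p (f : grhom m p) (g : grhom n p) :
  grcomp (gr_copair f g) (gr_inl m n) = f.
Proof.
apply: grhom_ext => i; rewrite /= free_lift_gen free_lift_gen.
by rewrite -[lshift n i]/(unsplit (inl i)) unsplitK.
Qed.

Lemma gr_copair_inr m n p (f : grhom m p) (g : grhom n p) :
  grcomp (gr_copair f g) (gr_inr m n) = g.
Proof.
apply: grhom_ext => i; rewrite /= free_lift_gen free_lift_gen.
by rewrite -[rshift m i]/(unsplit (inr i)) unsplitK.
Qed.

Lemma gr_sum_ext m n p (f g : grhom (m + n) p) :
  grcomp f (gr_inl m n) = grcomp g (gr_inl m n) ->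
  grcomp f (gr_inr m n) = grcomp g (gr_inr m n) -> f = g.
Proof.
move=> fgl fgr; apply: grhom_ext => i; rewrite -[i]splitK.
case: (split i) => j /=.
  by have := congr1 (fun h : grhom m p => h (gen j)) fgl; rewrite /= free_lift_gen.
by have := congr1 (fun h : grhom n p => h (gen j)) fgr; rewrite /= free_lift_gen.
Qed.

(* phi : n -> m * T is an isomorphism carrying u to the inclusion of m and v to
   the projection onto m, with T = Fr t. *)
Definition is_split m n (u : grhom m n) (v : grhom n m) : Prop :=
  exists t (phi : grhom n (m + t)) (psi : grhom (m + t) n),
    [/\ grcomp psi phi = idfun :> grhom n n,
        grcomp phi psi = idfun :> grhom (m + t) (m + t),
        grcomp phi u = gr_inl m t
      & v = grcomp (gr_proj m t) phi].

Lemma gr_triv_comp m n p (f : grhom n p) : grcomp f (gr_triv m n) = gr_triv m p.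
Proof. by apply: grhom_ext => i; rewrite /= !free_lift_gen gmulf1. Qed.

Lemma gr_comp_triv m n p (f : grhom m n) : grcomp (gr_triv n p) f = gr_triv m p.
Proof.
apply: grhom_ext => i; rewrite /= free_lift_gen /free_lift big1// => a _.
by rewrite /letter_val; case: a.2; rewrite ?invg1.
Qed.

Lemma is_split1 n : is_split (idfun : grhom n n) (idfun : grhom n n).
Proof.
exists 0%N, (gr_inl n 0), (gr_proj n 0); split; rewrite ?gr_copair_inl ?grcompm1//.
apply: gr_sum_ext; last by apply: grhom_ext => -[].
by rewrite -grcompA gr_copair_inl grcomp1m grcompm1.
Qed.

Lemma is_split_comp m n p u v u' v' :
  @is_split n p u v -> @is_split m n u' v' ->
  is_split (grcomp u u') (grcomp v' v).
Proof.
move=> [t [phi [psi [psiK phiK phiu ->]]]] [t' [phi' [psi' [psiK' phiK' phiu' ->]]]].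
pose A := gr_copair (gr_inl m (t' + t))
                    (grcomp (gr_inr m (t' + t)) (gr_inl t' t)).
pose B := grcomp (gr_inr m (t' + t)) (gr_inr t' t).
pose R := gr_copair (grcomp A phi') B.
pose S := gr_copair (grcomp (grcomp (gr_inl n t) psi') (gr_inl m t'))
  (gr_copair (grcomp (grcomp (gr_inl n t) psi') (gr_inr m t')) (gr_inr n t)).
have SA : grcomp S A = grcomp (gr_inl n t) psi'.
  apply: gr_sum_ext; rewrite -!grcompA.
    by rewrite !gr_copair_inl -!grcompA.
  by rewrite gr_copair_inr grcompA gr_copair_inr gr_copair_inl -!grcompA.
have SR : grcomp S R = idfun.
  apply: gr_sum_ext; rewrite -grcompA grcomp1m.
    by rewrite gr_copair_inl grcompA SA -grcompA psiK' grcompm1.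
  by rewrite gr_copair_inr grcompA gr_copair_inr gr_copair_inr.
have RS : grcomp R S = idfun.
  apply: gr_sum_ext; rewrite -grcompA grcomp1m.
    rewrite gr_copair_inl !grcompA gr_copair_inl -[grcomp _ psi']grcompA phiK'.
    by rewrite grcompm1 gr_copair_inl.
  rewrite gr_copair_inr; apply: gr_sum_ext; rewrite -grcompA.
    rewrite gr_copair_inl !grcompA gr_copair_inl -[grcomp _ psi']grcompA phiK'.
    by rewrite grcompm1 gr_copair_inr.
  by rewrite gr_copair_inr gr_copair_inr.
have pR : grcomp (gr_proj m (t' + t)) R =
          grcomp (grcomp (gr_proj m t') phi') (gr_proj n t).
  apply: gr_sum_ext; rewrite -!grcompA.
    rewrite !gr_copair_inl grcompm1 grcompA; congr grcomp.
    apply: gr_sum_ext; rewrite -grcompA.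
      by rewrite !gr_copair_inl.
    by rewrite !gr_copair_inr grcompA gr_copair_inr gr_comp_triv.
  by rewrite !gr_copair_inr /B grcompA gr_copair_inr gr_comp_triv !gr_triv_comp.
exists (t' + t)%N, (grcomp R phi), (grcomp psi S); split.
- by rewrite -grcompA (grcompA S) SR grcomp1m.
- by rewrite -grcompA (grcompA phi) phiK grcomp1m.
- rewrite -grcompA (grcompA phi) phiu grcompA gr_copair_inl -grcompA phiu'.
  by rewrite gr_copair_inl.
- by rewrite -!grcompA (grcompA _ R) pR -!grcompA.
Qed.

Record schom (m n : nat) := ScHom {
  sc_sec : grhom m n;
  sc_ret : grhom n m;
  sc_split : is_split sc_sec sc_ret
}.

Lemma schom_eq m n (f g : schom m n) :
  sc_sec f = sc_sec g -> sc_ret f = sc_ret g -> f = g.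
Proof.
case: f g => u v s [u' v' s'] /= uu' vv'; move: s s'; rewrite uu' vv' => s s'.
by rewrite (Prop_irrelevance s s').
Qed.

Definition scid n : schom n n := ScHom (is_split1 n).

Definition sccomp m n p (f : schom n p) (g : schom m n) : schom m p :=
  ScHom (is_split_comp (sc_split f) (sc_split g)).

Lemma sccomp1m m n (f : schom m n) : sccomp (scid n) f = f.
Proof. by apply: schom_eq; rewrite /= ?grcomp1m ?grcompm1. Qed.

Lemma sccompm1 m n (f : schom m n) : sccomp f (scid m) = f.
Proof. by apply: schom_eq; rewrite /= ?grcomp1m ?grcompm1. Qed.

Lemma sccompA m n p q (f : schom p q) (g : schom n p) (h : schom m n) :
  sccomp f (sccomp g h) = sccomp (sccomp f g) h.
Proof. by apply: schom_eq; rewrite /= grcompA. Qed.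

Definition Sc_gr : category :=
  {| obj := nat;
     hom := schom;
     idm := scid;
     comp := sccomp;
     comp1m := sccomp1m;
     compm1 := sccompm1;
     compA := sccompA;
     compA' := fun m n p q f g h => esym (sccompA f g h) |}.

Definition beta : functor Sc_gr (op gr) :=
  {| fob := (fun n => n) : Sc_gr -> op gr;
     fmap := fun m n (f : @hom Sc_gr m n) => sc_ret f : @hom (op gr) m n;
     fmap1 := fun n => erefl;
     fmapM := fun m n p f g => erefl |}.

(** * Modules *)

Section SubQuotientModule.
Variables (k : pzRingType) (V : lmodType k) (S : {pred V}).
Hypothesis subS : GRing.submod_closed S.

Definition submod_pred of GRing.submod_closed S : {pred V} := S.
Local Notation I := (submod_pred subS).
HB.instance Definition _ := GRing.isSubmodClosed.Build k V I subS.

Record sub_mod := SubMod { sub_val : V; _ : sub_val \in I }.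
HB.instance Definition _ := [isSub for sub_val].
HB.instance Definition _ := [Choice of sub_mod by <:].
HB.instance Definition _ := [SubChoice_isSubLmodule of sub_mod by <:].

Definition quot_mod := Quotient.quot I.
HB.instance Definition _ := GRing.Zmodule.on quot_mod.

Definition quot_pi (v : V) : quot_mod := \pi_(Quotient.quot I) v.

Lemma quot_piP (v w : V) : quot_pi v = quot_pi w <-> v - w \in S.
Proof.
rewrite -[S]/(I : {pred V}) Quotient.idealrBE.
by split => [/eqP|/eqP].
Qed.

Lemma quot_pi_surj (x : quot_mod) : exists v, quot_pi v = x.
Proof. by exists (repr x); apply: reprK. Qed.

Lemma quot_reprK (x : quot_mod) : quot_pi (repr x) = x.
Proof. exact: reprK. Qed.

Lemma quot_piD : {morph quot_pi : v w / v + w}.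
Proof. by move=> v w; rewrite /quot_pi piE. Qed.

Definition quot_scale (a : k) (x : quot_mod) : quot_mod := quot_pi (a *: repr x).

Lemma quot_piZ a v : quot_pi (a *: v) = quot_scale a (quot_pi v).
Proof.
apply/quot_piP; rewrite -scalerBr -[_ *: _]addr0.
by apply: subS.2 subS.1; apply/quot_piP; rewrite quot_reprK.
Qed.

Fact quot_scaleA a b x : quot_scale a (quot_scale b x) = quot_scale (a * b) x.
Proof. by rewrite -[x]quot_reprK -!quot_piZ scalerA. Qed.
Fact quot_scale1 : left_id 1 quot_scale.
Proof. by move=> x; rewrite -[x]quot_reprK -quot_piZ scale1r. Qed.
Fact quot_scaleDr : right_distributive quot_scale +%R.
Proof.
by move=> a x y; rewrite -[x]quot_reprK -[y]quot_reprK -quot_piD -!quot_piZ -quot_piD scalerDr.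
Qed.
Fact quot_scaleDl x : {morph quot_scale^~ x : a b / a + b}.
Proof. by move=> a b; rewrite -[x]quot_reprK -!quot_piZ scalerDl quot_piD. Qed.

HB.instance Definition _ := GRing.Zmodule_isLmodule.Build k quot_mod
  quot_scaleA quot_scale1 quot_scaleDr quot_scaleDl.

Fact quot_pi_linear : linear quot_pi.
Proof. by move=> a v w; rewrite quot_piD quot_piZ. Qed.
HB.instance Definition _ := GRing.isLinear.Build k V quot_mod _ quot_pi quot_pi_linear.

Section Lift.
Variables (W : lmodType k) (f : {linear V -> W}).

Definition quot_lift (_ : forall v, v \in S -> f v = 0) (x : quot_mod) : W :=
  f (repr x).

Hypothesis fI : forall v, v \in S -> f v = 0.

Lemma quot_liftE v : quot_lift fI (quot_pi v) = f v.
Proof.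
apply/eqP; rewrite -subr_eq0 -linearB fI//; apply/quot_piP.
by rewrite quot_reprK.
Qed.

Fact quot_lift_linear : linear (quot_lift fI).
Proof.
move=> a x y; have [[v <-] [w <-]] := (quot_pi_surj x, quot_pi_surj y).
by rewrite -linearP !quot_liftE linearP.
Qed.
HB.instance Definition _ :=
  GRing.isLinear.Build k quot_mod W _ (quot_lift fI) quot_lift_linear.
End Lift.

End SubQuotientModule.

(* The k-module with generators X, subject to the relations w = 0 for w in R;
   the list [:: (r1, x1); ...] stands for r1 x1 + .... *)
Section Presented.
Variables (k : pzRingType) (X : Type) (R : seq (k * X) -> Prop).
Implicit Types w : seq (k * X).

Definition scale_word (r : k) w := [seq (r * m.1, m.2) | m <- w].

Inductive pres_eq : seq (k * X) -> seq (k * X) -> Prop :=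
| pres_refl w : pres_eq w w
| pres_sym w1 w2 : pres_eq w1 w2 -> pres_eq w2 w1
| pres_trans w1 w2 w3 : pres_eq w1 w2 -> pres_eq w2 w3 -> pres_eq w1 w3
| pres_cat w1 w1' w2 w2' :
    pres_eq w1 w1' -> pres_eq w2 w2' -> pres_eq (w1 ++ w2) (w1' ++ w2')
| pres_catC w1 w2 : pres_eq (w1 ++ w2) (w2 ++ w1)
| pres_0 x : pres_eq [:: (0, x)] [::]
| pres_add r s x : pres_eq [:: (r, x); (s, x)] [:: (r + s, x)]
| pres_rel r w : R w -> pres_eq (scale_word r w) [::].

Definition pres_eqb (w1 w2 : {classic seq (k * X)}) : bool := `[< pres_eq w1 w2 >].

Lemma pres_eqb_equiv : equiv_class_of pres_eqb.
Proof.
split.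
- by move=> w; apply/asboolP/pres_refl.
- by move=> w1 w2; apply/asboolP/asboolP; apply: pres_sym.
- by move=> w1 w2 w3 /asboolP h1 /asboolP h2; apply/asboolP/(pres_trans h1 h2).
Qed.
Canonical pres_eqb_equivRel := EquivRelPack pres_eqb_equiv.
Canonical pres_eqb_encModRel := defaultEncModRel pres_eqb.

Definition presented := {eq_quot pres_eqb}.
HB.instance Definition _ := Choice.on presented.

Definition pres_pi w : presented := \pi_({eq_quot pres_eqb}) (w : {classic _}).
Definition pres_repr (p : presented) : seq (k * X) := repr p.

Lemma pres_piP w1 w2 : pres_pi w1 = pres_pi w2 <-> pres_eq w1 w2.
Proof.
split; first by move/eqP; rewrite /pres_pi piE => /asboolP.
by move=> h; apply/eqP; rewrite /pres_pi piE; apply/asboolP.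
Qed.

Lemma pres_reprK p : pres_pi (pres_repr p) = p.
Proof. exact: reprK. Qed.

Lemma pres_repr_pi w : pres_eq (pres_repr (pres_pi w)) w.
Proof. by apply/pres_piP; rewrite pres_reprK. Qed.

Lemma scale_word_cat r w1 w2 :
  scale_word r (w1 ++ w2) = scale_word r w1 ++ scale_word r w2.
Proof. exact: map_cat. Qed.

Lemma scale_wordA r s w : scale_word r (scale_word s w) = scale_word (r * s) w.
Proof. by rewrite /scale_word -map_comp; apply: eq_map => m /=; rewrite mulrA. Qed.

Lemma scale_word_eq r w1 w2 :
  pres_eq w1 w2 -> pres_eq (scale_word r w1) (scale_word r w2).
Proof.
elim=> {w1 w2}.
- by move=> w; apply: pres_refl.
- by move=> w1 w2 _ /pres_sym.
- by move=> w1 w2 w3 _ h1 _ h2; apply: pres_trans h1 h2.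
- by move=> w1 w1' w2 w2' _ h1 _ h2; rewrite !scale_word_cat; apply: pres_cat.
- by move=> w1 w2; rewrite !scale_word_cat; apply: pres_catC.
- by move=> x; rewrite /= mulr0; apply: pres_0.
- by move=> s t x; rewrite /= mulrDr; apply: pres_add.
- by move=> s w Rw; rewrite scale_wordA; apply: pres_rel.
Qed.

Lemma scale_wordDl r s w :
  pres_eq (scale_word (r + s) w) (scale_word r w ++ scale_word s w).
Proof.
elim: w => [|m w IHw] /=; first exact: pres_refl.
apply: (@pres_trans _ ([:: (r * m.1, m.2); (s * m.1, m.2)] ++
                       (scale_word r w ++ scale_word s w))).
  rewrite mulrDl -cat1s; apply: pres_cat => //.
  exact/pres_sym/pres_add.
rewrite -[(r * m.1, m.2) :: _ ++ _]cat1s -[[:: _; _]]cat1s -!catA.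
apply: pres_cat; first exact: pres_refl.
rewrite !catA -[(s * m.1, m.2) :: scale_word s w]cat1s !catA.
by apply: pres_cat; [apply: pres_catC | apply: pres_refl].
Qed.

Lemma scale_word0 w : pres_eq (scale_word 0 w) [::].
Proof.
elim: w => [|m w IHw] /=; first exact: pres_refl.
rewrite mul0r -cat1s -[[::]]cat0s; apply: pres_cat => //; exact: pres_0.
Qed.

Lemma scale_word1 w : scale_word 1 w = w.
Proof. by elim: w => //= -[r x] w ->; rewrite mul1r. Qed.

Definition pres_add_op p q := pres_pi (pres_repr p ++ pres_repr q).
Definition pres_scale (r : k) p := pres_pi (scale_word r (pres_repr p)).

Lemma pres_piD w1 w2 :
  pres_pi (w1 ++ w2) = pres_add_op (pres_pi w1) (pres_pi w2).
Proof. by apply/pres_piP/pres_cat; apply/pres_sym/pres_repr_pi. Qed.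

Lemma pres_piZ r w : pres_pi (scale_word r w) = pres_scale r (pres_pi w).
Proof. by apply/pres_piP/scale_word_eq/pres_sym/pres_repr_pi. Qed.

Fact pres_addA : associative pres_add_op.
Proof.
move=> p q r; rewrite -[p]pres_reprK -[q]pres_reprK -[r]pres_reprK.
by rewrite -!pres_piD catA.
Qed.
Fact pres_addC : commutative pres_add_op.
Proof. by move=> p q; apply/pres_piP/pres_catC. Qed.
Fact pres_add0 : left_id (pres_pi [::]) pres_add_op.
Proof. by move=> p; rewrite -{1}[p]pres_reprK -pres_piD pres_reprK. Qed.
Fact pres_addN : left_inverse (pres_pi [::]) (pres_scale (-1)) pres_add_op.
Proof.
move=> p; rewrite -[p]pres_reprK -pres_piZ -pres_piD; apply/pres_piP.
rewrite -{2}[pres_repr p]scale_word1; apply: pres_trans (scale_word0 (pres_repr p)).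
by rewrite -[0](addNr 1); apply/pres_sym/scale_wordDl.
Qed.
HB.instance Definition _ :=
  GRing.isZmodule.Build presented pres_addA pres_addC pres_add0 pres_addN.

Fact pres_scaleA r s p : pres_scale r (pres_scale s p) = pres_scale (r * s) p.
Proof. by rewrite -[p]pres_reprK -!pres_piZ scale_wordA. Qed.
Fact pres_scale1 : left_id 1 pres_scale.
Proof. by move=> p; rewrite -[p]pres_reprK -pres_piZ scale_word1. Qed.
Fact pres_scaleDr : right_distributive pres_scale +%R.
Proof.
move=> r p q; rewrite -[p]pres_reprK -[q]pres_reprK.
by rewrite -[_ + _]pres_piD -!pres_piZ scale_word_cat pres_piD.
Qed.
Fact pres_scaleDl p : {morph pres_scale^~ p : r s / r + s}.
Proof.
move=> r s; rewrite -[p]pres_reprK -!pres_piZ -[RHS]pres_piD.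
exact/pres_piP/scale_wordDl.
Qed.
HB.instance Definition _ := GRing.Zmodule_isLmodule.Build k presented
  pres_scaleA pres_scale1 pres_scaleDr pres_scaleDl.

Definition pres_gen (x : X) : presented := pres_pi [:: (1, x)].

Lemma pres_piE w : pres_pi w = \sum_(m <- w) m.1 *: pres_gen m.2.
Proof.
elim: w => [|[r x] w IHw]; first by rewrite big_nil.
rewrite big_cons -IHw -cat1s pres_piD; congr (_ + _).
by rewrite /pres_gen -[RHS]pres_piZ /= mulr1.
Qed.

Lemma pres_genE p : exists w, p = \sum_(m <- w) m.1 *: pres_gen m.2.
Proof. by exists (pres_repr p); rewrite -pres_piE pres_reprK. Qed.

Lemma pres_gen_rel w : R w -> \sum_(m <- w) m.1 *: pres_gen m.2 = 0.
Proof.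
move=> Rw; rewrite -pres_piE; apply/pres_piP; rewrite -[w]scale_word1.
exact: pres_rel.
Qed.

Section Lift.
Variables (W : lmodType k) (f : X -> W).

Definition word_val w : W := \sum_(m <- w) m.1 *: f m.2.

Definition pres_lift (_ : forall w, R w -> word_val w = 0) (p : presented) : W :=
  word_val (pres_repr p).

Hypothesis fR : forall w, R w -> word_val w = 0.

Lemma word_valZ r w : word_val (scale_word r w) = r *: word_val w.
Proof.
rewrite /word_val big_map scaler_sumr; apply: eq_bigr => m _.
by rewrite scalerA.
Qed.

Lemma word_val_eq w1 w2 : pres_eq w1 w2 -> word_val w1 = word_val w2.
Proof.
elim=> {w1 w2} //.
- by move=> w1 w2 w3 _ -> _ ->.
- by move=> w1 w1' w2 w2' _ h1 _ h2; rewrite /word_val !big_cat /= -!/(word_val _) h1 h2.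
- by move=> w1 w2; rewrite /word_val !big_cat /= addrC.
- by move=> x; rewrite /word_val big_seq1 big_nil scale0r.
- by move=> r s x; rewrite /word_val big_cons !big_seq1 scalerDl.
- by move=> r w Rw; rewrite word_valZ fR// scaler0 /word_val big_nil.
Qed.

Lemma pres_lift_pi w : pres_lift fR (pres_pi w) = word_val w.
Proof. exact/word_val_eq/pres_repr_pi. Qed.

Fact pres_lift_linear : linear (pres_lift fR).
Proof.
move=> r p q; rewrite -[p]pres_reprK -[q]pres_reprK.
rewrite -[r *: _]pres_piZ -[_ + _]pres_piD !pres_lift_pi -word_valZ.
by rewrite /word_val big_cat.
Qed.
HB.instance Definition _ :=
  GRing.isLinear.Build k presented W _ (pres_lift fR) pres_lift_linear.

Lemma pres_lift_gen x : pres_lift fR (pres_gen x) = f x.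
Proof. by rewrite pres_lift_pi /word_val big_seq1 scale1r. Qed.
End Lift.

Lemma presented_ext (W : lmodType k) (f g : {linear presented -> W}) :
  (forall x, f (pres_gen x) = g (pres_gen x)) -> f =1 g.
Proof.
move=> fg p; have [w ->] := pres_genE p; rewrite !linear_sum.
by apply: eq_bigr => m _; rewrite !linearZ fg.
Qed.

End Presented.

(** * Functors to k-modules and natural transformations *)

Record modF (k : pzRingType) (C : category) := ModF {
  mob :> C -> lmodType k;
  mmap : forall x y, hom x y -> {linear mob x -> mob y};
  mmap1 : forall x a, mmap (idm x) a = a;
  mmapM : forall x y z (f : hom y z) (g : hom x y) a,
    mmap (comp f g) a = mmap f (mmap g a)
}.
Arguments mmap {k C} M {x y} f : rename.

Record modT (k : pzRingType) (C : category) (M N : modF k C) := ModT {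
  mtr :> forall x, {linear M x -> N x};
  mtr_nat : forall x y (f : hom x y) a, mtr y (mmap M f a) = mmap N f (mtr x a)
}.

Definition pull (k : pzRingType) (C D : category) (phi : functor C D)
    (M : modF k D) : modF k C.
Proof.
refine (@ModF k C (fun x => M (phi x)) (fun x y f => mmap M (fmap phi f)) _ _).
- by move=> x a; rewrite fmap1 mmap1.
- by move=> x y z f g a; rewrite fmapM mmapM.
Defined.

(** * Analytic functors *)

(* The free product of the a j is \sum_j a j, whose generators are the
   tagnat.Rank j s with s < a j; omit a i includes the free product of the a j
   with j != i into it. *)
Definition omit d (a : 'I_d.+1 -> nat) (i : 'I_d.+1) :
    @hom gr (\sum_j a (lift i j))%N (\sum_j a j)%N :=
  free_lift (fun s => gen (@tagnat.Rank _ a (lift i (tagnat.sig1 s))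
                                        (@tagnat.sig2 _ (fun j => a (lift i j)) s))).

(* F is polynomial of degree at most d. *)
Definition polynomial_le (k : pzRingType) (d : nat) (F : modF k (op gr)) : Prop :=
  forall (a : 'I_d.+1 -> nat) (x : F (\sum_j a j)%N),
    (forall i, mmap F (omit a i : @hom (op gr) _ _) x = 0) -> x = 0.

Definition polynomial (k : pzRingType) (F : modF k (op gr)) : Prop :=
  exists d, polynomial_le d F.

Record diagram (k : pzRingType) (C J : category) := Diagram {
  dob :> J -> modF k C;
  dmap : forall i j, hom i j -> modT (dob i) (dob j);
  dmap1 : forall i x a, dmap (idm i) x a = a;
  dmapM : forall i j l (f : hom j l) (g : hom i j) x a,
    dmap (comp f g) x a = dmap f x (dmap g x a)
}.

Definition is_cocone (k : pzRingType) (C J : category) (D : diagram k C J)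
    (M : modF k C) (c : forall j, modT (D j) M) : Prop :=
  forall i j (f : hom i j) x a, c j x (dmap D f x a) = c i x a.

Definition is_colimit (k : pzRingType) (C J : category) (D : diagram k C J)
    (M : modF k C) (c : forall j, modT (D j) M) : Prop :=
  is_cocone c /\
  forall (N : modF k C) (e : forall j, modT (D j) N), is_cocone e ->
    exists h : modT M N,
      (forall j x a, h x (c j x a) = e j x a) /\
      forall h' : modT M N, (forall j x a, h' x (c j x a) = e j x a) ->
        forall x a, h' x a = h x a.

Definition analytic (k : pzRingType) (F : modF k (op gr)) : Prop :=
  exists (J : category) (D : diagram k (op gr) J) (c : forall j, modT (D j) F),
    (forall j, polynomial (D j)) /\ is_colimit c.

(** * The tensor product over a category *)

Section Tensor.
Variables (k : comPzRingType) (C : category).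
Variables (A : modF k (op C)) (B : modF k C).

Definition pure := {x : C & (A x * B x)%type}.
Definition mkpure x (a : A x) (b : B x) : pure := existT _ x (a, b).

(* The coend of x, y |-> A x (x) B y, by generators and relations. *)
Inductive tens_rel : seq (k * pure) -> Prop :=
| tens_relDl x (a a' : A x) (b : B x) :
    tens_rel [:: (1, mkpure (a + a') b); (-1, mkpure a b); (-1, mkpure a' b)]
| tens_relDr x (a : A x) (b b' : B x) :
    tens_rel [:: (1, mkpure a (b + b')); (-1, mkpure a b); (-1, mkpure a b')]
| tens_relZl x r (a : A x) (b : B x) :
    tens_rel [:: (1, mkpure (r *: a) b); (- r, mkpure a b)]
| tens_relZr x r (a : A x) (b : B x) :
    tens_rel [:: (1, mkpure a (r *: b)); (- r, mkpure a b)]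
| tens_relF x y (f : @hom C x y) (a : A y) (b : B x) :
    tens_rel [:: (1, mkpure (mmap A (f : @hom (op C) y x) a) b);
                 (-1, mkpure a (mmap B f b))].

Definition tensor : lmodType k := presented tens_rel.

Definition tens x (a : A x) (b : B x) : tensor := pres_gen tens_rel (mkpure a b).

Section Lift.
Variable W : lmodType k.

Record balanced (h : forall x, A x -> B x -> W) : Prop := Balanced {
  balDl : forall x a a' b, h x (a + a') b = h x a b + h x a' b;
  balDr : forall x a b b', h x a (b + b') = h x a b + h x a b';
  balZl : forall x r a b, h x (r *: a) b = r *: h x a b;
  balZr : forall x r a b, h x a (r *: b) = r *: h x a b;
  balF : forall x y (f : @hom C x y) a b,
    h x (mmap A (f : @hom (op C) y x) a) b = h y a (mmap B f b)
}.

Variables (h : forall x, A x -> B x -> W) (bal_h : balanced h).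

Definition pure_val (p : pure) : W := h (tagged p).1 (tagged p).2.

Lemma pure_val_rel w : tens_rel w -> word_val pure_val w = 0.
Proof.
by case: bal_h => hDl hDr hZl hZr hF; case=> *;
  rewrite /word_val !big_cons big_nil /pure_val /= ?hDl ?hDr ?hZl ?hZr ?hF
    ?scale1r ?scaleN1r ?scaleNr addr0 ?subrr// -?opprD ?subrr.
Qed.

Definition tens_lift : {linear tensor -> W} := pres_lift pure_val_rel.

Lemma tens_liftE x (a : A x) (b : B x) : tens_lift (tens a b) = h a b.
Proof. exact: pres_lift_gen. Qed.
End Lift.

Lemma tens_balanced : balanced tens.
Proof.
split=> [x a a' b|x a b b'|x r a b|x r a b|x y f a b];
  apply/eqP; rewrite -subr_eq0; apply/eqP.
- rewrite -(pres_gen_rel (tens_relDl a a' b)) !big_cons big_nil /=.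
  by rewrite scale1r !scaleN1r addr0 opprD.
- rewrite -(pres_gen_rel (tens_relDr a b b')) !big_cons big_nil /=.
  by rewrite scale1r !scaleN1r addr0 opprD.
- rewrite -(pres_gen_rel (tens_relZl r a b)) !big_cons big_nil /=.
  by rewrite scale1r scaleNr addr0.
- rewrite -(pres_gen_rel (tens_relZr r a b)) !big_cons big_nil /=.
  by rewrite scale1r scaleNr addr0.
- rewrite -(pres_gen_rel (tens_relF f a b)) !big_cons big_nil /=.
  by rewrite scale1r scaleN1r addr0.
Qed.

Lemma tensor_ext (W : lmodType k) (f g : {linear tensor -> W}) :
  (forall x (a : A x) (b : B x), f (tens a b) = g (tens a b)) -> f =1 g.
Proof. by move=> fg; apply: presented_ext => -[x [a b]]; apply: fg. Qed.

End Tensor.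

Section TensorMaps.
Variable k : comPzRingType.

Section Mapl.
Variables (C : category) (A A' : modF k (op C)) (B : modF k C) (u : modT A A').

Definition mapl_fun x (a : A x) (b : B x) := tens (u x a) b.

Lemma mapl_balanced : balanced mapl_fun.
Proof.
have [hDl hDr hZl hZr hF] := tens_balanced A' B; rewrite /mapl_fun.
split=> *; rewrite ?linearD ?linearZ ?hDl ?hDr ?hZl ?hZr//.
by rewrite (mtr_nat u) hF.
Qed.

Definition tens_mapl : {linear tensor A B -> tensor A' B} := tens_lift mapl_balanced.

Lemma tens_maplE x (a : A x) (b : B x) : tens_mapl (tens a b) = tens (u x a) b.
Proof. exact: tens_liftE. Qed.
End Mapl.

Section Mapr.
Variables (C : category) (A : modF k (op C)) (B B' : modF k C) (u : modT B B').

Definition mapr_fun x (a : A x) (b : B x) := tens a (u x b).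

Lemma mapr_balanced : balanced mapr_fun.
Proof.
have [hDl hDr hZl hZr hF] := tens_balanced A B'; rewrite /mapr_fun.
split=> *; rewrite ?linearD ?linearZ ?hDl ?hDr ?hZl ?hZr//.
by rewrite (mtr_nat u) hF.
Qed.

Definition tens_mapr : {linear tensor A B -> tensor A B'} := tens_lift mapr_balanced.

Lemma tens_maprE x (a : A x) (b : B x) : tens_mapr (tens a b) = tens a (u x b).
Proof. exact: tens_liftE. Qed.
End Mapr.

Section Pull.
Variables (C D : category) (phi : functor C D) (A : modF k (op D)) (B : modF k D).
Local Notation A' := (pull (opF phi) A).
Local Notation B' := (pull phi B).

Definition pull_fun x (a : A' x) (b : B' x) : tensor A B := @tens k D A B (phi x) a b.

Lemma pull_balanced : balanced pull_fun.
Proof.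
have [hDl hDr hZl hZr hF] := tens_balanced A B; rewrite /pull_fun.
split=> /= *; [exact: hDl|exact: hDr|exact: hZl|exact: hZr|exact: hF].
Qed.

Definition tens_pull : {linear tensor A' B' -> tensor A B} := tens_lift pull_balanced.
End Pull.

Section Swap.
Variables (C : category) (A : modF k (op C)) (B : modF k C).

Definition swap_fun x (a : A x) (b : B x) : @tensor k (op C) B A :=
  @tens k (op C) B A x b a.

Lemma swap_balanced : balanced swap_fun.
Proof.
have [hDl hDr hZl hZr hF] := @tens_balanced k (op C) B A; rewrite /swap_fun.
split=> *; rewrite ?hDl ?hDr ?hZl ?hZr//; exact/esym/hF.
Qed.

Definition tens_swap : {linear tensor A B -> @tensor k (op C) B A} :=
  tens_lift swap_balanced.
End Swap.

End TensorMaps.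

(** * Homology of chain complexes *)

Section Homology.
Variable k : pzRingType.

Record chain_complex := ChainComplex {
  cob :> nat -> lmodType k;
  cd : forall n, {linear cob n.+1 -> cob n};
  cd_cd : forall n x, cd n (cd n.+1 x) = 0
}.

Record chain_map (X Y : chain_complex) := ChainMap {
  cmap :> forall n, {linear X n -> Y n};
  cmap_cd : forall n x, cmap n (cd X n x) = cd Y n (cmap n.+1 x)
}.

Variable X : chain_complex.

Definition is_cycle n : {pred X n} :=
  match n with
  | 0 => fun=> true
  | n'.+1 => fun x => cd X n' x == 0
  end.

Lemma is_cycle_submod n : GRing.submod_closed (@is_cycle n).
Proof.
case: n => [//|n]; split=> [|a x y]; rewrite !unfold_in /= ?linear0//.
by move=> /eqP dx /eqP dy; rewrite linearP dx dy scaler0 addr0.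
Qed.

Definition cycles n : lmodType k := sub_mod (is_cycle_submod n).

Definition is_boundary n : {pred cycles n} :=
  fun z => `[< exists y, val z = cd X n y >].

Lemma is_boundary_submod n : GRing.submod_closed (@is_boundary n).
Proof.
split=> [|a x y]; first by apply/asboolP; exists 0; rewrite !linear0.
move=> /asboolP[x' xE] /asboolP[y' yE]; apply/asboolP.
by exists (a *: x' + y'); rewrite !linearP /= xE yE.
Qed.

Definition homology n : lmodType k := quot_mod (is_boundary_submod n).

End Homology.

Section HomologyMap.
Variables (k : pzRingType) (X Y : chain_complex k) (f : chain_map X Y) (n : nat).

Lemma cmap_cycle (z : cycles X n) : f n (val z) \in @is_cycle _ Y n.
Proof.
case: z => z /=; case: n z => [//|m] z; rewrite !unfold_in /= => /eqP dz.
by rewrite -cmap_cd dz linear0.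
Qed.

Definition cycles_map (z : cycles X n) : cycles Y n :=
  @SubMod _ _ _ (is_cycle_submod Y n) _ (cmap_cycle z).

Fact cycles_map_linear : linear cycles_map.
Proof. by move=> a x y; apply: val_inj; rewrite /= !linearP. Qed.
HB.instance Definition _ :=
  GRing.isLinear.Build k (cycles X n) (cycles Y n) _ cycles_map cycles_map_linear.

Definition homology_cycles : {linear cycles X n -> homology Y n} :=
  @quot_pi _ _ _ (is_boundary_submod Y n) \o cycles_map.

Lemma homology_cycles_boundary z :
  z \in @is_boundary _ X n -> homology_cycles z = 0.
Proof.
move=> /asboolP[y zE]; rewrite -(linear0 (@quot_pi _ _ _ (is_boundary_submod Y n))).
apply/quot_piP; rewrite subr0; apply/asboolP; exists (f n.+1 y).
by rewrite /= zE cmap_cd.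
Qed.

Definition homology_map : {linear homology X n -> homology Y n} :=
  quot_lift homology_cycles_boundary.

Lemma homology_mapE z :
  homology_map (quot_pi (is_boundary_submod X n) z) =
  quot_pi (is_boundary_submod Y n) (cycles_map z).
Proof. exact: quot_liftE. Qed.

End HomologyMap.

(** * Tor *)

(* Epimorphisms of functors are the pointwise surjections. *)
Definition projective (k : pzRingType) (C : category) (P : modF k C) : Prop :=
  forall (M N : modF k C) (e : modT M N) (f : modT P N),
    (forall x b, exists a, e x a = b) ->
    exists g : modT P M, forall x p, e x (g x p) = f x p.

Record resolution (k : pzRingType) (C : category) (A : modF k C) := Resolution {
  res :> nat -> modF k C;
  res_d : forall n, modT (res n.+1) (res n);
  res_e : modT (res 0) A;
  res_proj : forall n, projective (res n);
  res_surj : forall x a, exists p, res_e x p = a;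
  res_exact0 : forall x p, res_e x p = 0 <-> exists q, p = res_d 0 x q;
  res_exact : forall n x p, res_d n x p = 0 <-> exists q, p = res_d n.+1 x q
}.

(* A chain map from a resolution of phi^* A to phi^* of a resolution of A,
   lifting the identity of phi^* A. *)
Record res_lift (k : pzRingType) (C D : category) (phi : functor C D)
    (A : modF k D) (P : resolution (pull phi A)) (Q : resolution A) := ResLift {
  rlift :> forall n, modT (P n) (pull phi (Q n));
  rlift_d : forall n x p,
    rlift n x (res_d P n x p) = res_d Q n (phi x) (rlift n.+1 x p);
  rlift_e : forall x p, res_e Q (phi x) (rlift 0 x p) = res_e P x p
}.

Section Tor.
Variable k : comPzRingType.

Section Complexes.
Variables (C : category) (A : modF k (op C)) (B : modF k C).
Variables (P : resolution A) (Q : resolution B).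

Lemma res_dd (E : category) (M : modF k E) (R : resolution M) n x q :
  res_d R n x (res_d R n.+1 x q) = 0.
Proof. by apply/res_exact; exists q. Qed.

Definition tens_res_l : chain_complex k.
Proof.
refine (@ChainComplex k (fun n => tensor (P n) B) (fun n => tens_mapl B (res_d P n)) _).
move=> n; apply: (@tensor_ext _ _ _ _ _ (tens_mapl B (res_d P n) \o
  tens_mapl B (res_d P n.+1)) \0) => x a b /=.
rewrite !tens_maplE res_dd; have := balZl (tens_balanced (P n) B) 0 0 b.
by rewrite !scale0r.
Defined.

Definition tens_res_r : chain_complex k.
Proof.
refine (@ChainComplex k (fun n => tensor A (Q n)) (fun n => tens_mapr A (res_d Q n)) _).
move=> n; apply: (@tensor_ext _ _ _ _ _ (tens_mapr A (res_d Q n) \o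
  tens_mapr A (res_d Q n.+1)) \0) => x a b /=.
rewrite !tens_maprE res_dd; have := balZr (tens_balanced A (Q n)) 0 a 0.
by rewrite !scale0r.
Defined.

End Complexes.

(* Tor^C_n(A, B), computed from a projective resolution P of A, resp. from a
   projective resolution Q of B. *)
Definition Tor_l (C : category) (A : modF k (op C)) (P : resolution A)
  (B : modF k C) (n : nat) : lmodType k := homology (tens_res_l B P) n.

Definition Tor_r (C : category) (A : modF k (op C)) (B : modF k C)
  (Q : resolution B) (n : nat) : lmodType k := homology (tens_res_r A Q) n.

Section Pull.
Variables (C D : category) (phi : functor C D) (A : modF k (op D)) (B : modF k D).
Variables (P : resolution (pull (opF phi) A)) (Q : resolution A).
Variable (u : res_lift P Q).

Definition tens_res_pull :
  chain_map (tens_res_l (pull phi B) P) (tens_res_l B Q).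
Proof.
exists (fun n => tens_pull phi (Q n) B \o tens_mapl (pull phi B) (u n)
                 : {linear tensor (P n) (pull phi B) -> tensor (Q n) B}) => n.
apply: (@tensor_ext _ _ _ _ _
  ((tens_pull phi (Q n) B \o tens_mapl (pull phi B) (u n)) \o
     tens_mapl (pull phi B) (res_d P n))
  (tens_mapl B (res_d Q n) \o
    (tens_pull phi (Q n.+1) B \o tens_mapl (pull phi B) (u n.+1)))) => x a b /=.
by rewrite !tens_maplE !tens_liftE /pull_fun /mapl_fun rlift_d.
Defined.

(* The morphism Tor^C_n(phi^* A, phi^* B) -> Tor^D_n(A, B) induced by phi. *)
Definition Tor_pull n : {linear Tor_l P (pull phi B) n -> Tor_l Q B n} :=
  homology_map tens_res_pull n.
End Pull.

Section Swap.
Variables (C : category) (A : modF k (op C)) (B : modF k C) (P : resolution A).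

Definition tens_res_swap :
  chain_map (tens_res_l B P) (@tens_res_r (op C) B A P).
Proof.
exists (fun n => tens_swap (P n) B) => n.
apply: (@tensor_ext _ _ _ _ _
  (tens_swap (P n) B \o tens_mapl B (res_d P n))
  (@tens_mapr k (op C) B _ _ (res_d P n) \o tens_swap (P n.+1) B)) => x a b /=.
by rewrite tens_maplE !tens_liftE.
Defined.

(* The canonical isomorphism Tor^C_n(A, B) = Tor^(op C)_n(B, A). *)
Definition Tor_swap n : {linear Tor_l P B n -> @Tor_r (op C) B A P n} :=
  homology_map tens_res_swap n.
End Swap.

End Tor.

Section TorBeta.
Variables (k : comPzRingType) (F : modF k (op gr)) (G : modF k gr).
Variables (P : resolution (pull (opF beta) G)) (Q : resolution G).
Variable u : res_lift P Q.

(* The morphism Tor^S_c(gr)_n(beta^* G, beta^* F) -> Tor^gr_n(F, G). *)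
Definition Tor_beta n : {linear Tor_l P (pull beta F) n -> Tor_r F Q n} :=
  Tor_swap F Q n \o Tor_pull F u n.
End TorBeta.

(** * Existence of projective resolutions and of lifts *)

(* Every functor has a projective resolution and every pair of resolutions as in
   res_lift is related by a lift, so quantifying over them is not vacuous. *)

Section SubFunctor.
Variables (k : pzRingType) (C : category) (M : modF k C).
Variable S : forall x, {pred M x}.
Hypotheses (subS : forall x, GRing.submod_closed (@S x))
  (stabS : forall x y (f : hom x y) a, a \in @S x -> mmap M f a \in @S y).

Definition subF_map x y (f : hom x y) (z : sub_mod (subS x)) : sub_mod (subS y) :=
  SubMod (subS := subS y) (stabS f (valP z)).

Fact subF_map_linear x y (f : hom x y) : linear (subF_map f).
Proof. by move=> a z t; apply: val_inj; rewrite /= !linearP. Qed.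
HB.instance Definition _ x y (f : hom x y) :=
  GRing.isLinear.Build k _ _ _ (subF_map f) (subF_map_linear f).

Definition subF : modF k C.
Proof.
refine (@ModF k C (fun x => sub_mod (subS x)) (fun x y f => subF_map f) _ _).
- by move=> x z; apply: val_inj; rewrite /= mmap1.
- by move=> x y t f g z; apply: val_inj; rewrite /= mmapM.
Defined.

Definition subF_val : modT subF M.
Proof. by exists (fun x => val : {linear sub_mod (subS x) -> M x}). Defined.

Section Factor.
Variables (N : modF k C) (f : modT N M) (fS : forall x a, f x a \in @S x).

Definition subF_fun x (a : N x) : sub_mod (subS x) :=
  SubMod (subS := subS x) (fS a).
Fact subF_fun_linear x : linear (@subF_fun x).
Proof. by move=> c a b; apply: val_inj; rewrite /= !linearP. Qed.
HB.instance Definition _ x :=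
  GRing.isLinear.Build k _ _ _ (@subF_fun x) (@subF_fun_linear x).

Definition subF_factor : modT N subF.
Proof.
exists (fun x => @subF_fun x : {linear N x -> sub_mod (subS x)}) => x y h a.
by apply: val_inj; rewrite /= mtr_nat.
Defined.
End Factor.
End SubFunctor.

Lemma projective_lift (k : pzRingType) (C : category) (P X Y : modF k C)
    (d : modT X Y) (f : modT P Y) : projective P ->
  (forall x p, exists a, f x p = d x a) ->
  exists g : modT P X, forall x p, d x (g x p) = f x p.
Proof.
move=> projP fd; pose S x : {pred Y x} := fun b => `[< exists a, b = d x a >].
have subS x : GRing.submod_closed (S x).
  split=> [|c a b]; first by apply/asboolP; exists 0; rewrite linear0.
  move=> /asboolP[a' ->] /asboolP[b' ->]; apply/asboolP.
  by exists (c *: a' + b'); rewrite linearP.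
have stabS x y (h : hom x y) b : b \in S x -> mmap Y h b \in S y.
  by move=> /asboolP[a ->]; apply/asboolP; exists (mmap X h a); rewrite mtr_nat.
have dS x a : d x a \in S x by apply/asboolP; exists a.
have fS x p : f x p \in S x by apply/asboolP; apply: fd.
have [|g gE] := projP _ _ (subF_factor subS stabS dS) (subF_factor subS stabS fS).
  move=> x [b Sb]; have /asboolP[a bE] := Sb.
  by exists a; apply: val_inj; rewrite /= -bE.
by exists g => x p; have := congr1 val (gE x p).
Qed.

Section FreeFunctor.
Variables (k : pzRingType) (C : category) (A : modF k C).

(* The sum over all c and all a in A c of the functors k[hom(c, -)]. *)
Definition fgen x := {c : C & (@hom C c x * A c)%type}.
Definition free_mod x : lmodType k := @presented k (fgen x) (fun=> False).
Definition fgen_map x y (f : hom x y) (g : fgen x) : free_mod y :=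
  pres_gen (fun=> False)
    (existT _ (tag g) (comp f (tagged g).1, (tagged g).2) : fgen y).
Lemma no_rel (X : Type) (W : lmodType k) (h : X -> W) (w : seq (k * X)) :
  False -> word_val h w = 0.
Proof. by []. Qed.
Definition free_map x y (f : hom x y) : {linear free_mod x -> free_mod y} :=
  pres_lift (@no_rel _ _ (fgen_map f)).

Definition freeF : modF k C.
Proof.
refine (@ModF k C free_mod free_map _ _).
- move=> x a; apply: (@presented_ext _ _ _ _ (free_map (idm x)) idfun) => -[c [h b]].
  by rewrite [LHS]pres_lift_gen /fgen_map /= comp1m.
- move=> x y z f g a.
  apply: (@presented_ext _ _ _ _ (free_map (comp f g)) (free_map f \o free_map g)).
  by move=> -[c [h b]]; rewrite /= !pres_lift_gen /fgen_map /= -compA.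
Defined.

Section FreeLift.
Variables (N : modF k C) (h : forall c, A c -> N c).
Definition free_lift_fun x (g : fgen x) : N x := mmap N (tagged g).1 (h (tagged g).2).
Definition freeF_lift : modT freeF N.
Proof.
exists (fun x => pres_lift (@no_rel _ _ (@free_lift_fun x))
              : {linear free_mod x -> N x}) => x y f.
apply: (@presented_ext _ _ _ _
  (pres_lift (@no_rel _ _ (@free_lift_fun y)) \o free_map f)
  (mmap N f \o pres_lift (@no_rel _ _ (@free_lift_fun x)))) => -[c [g b]].
by rewrite /= !pres_lift_gen /free_lift_fun /= mmapM.
Defined.

Lemma freeF_liftE x (g : fgen x) :
  freeF_lift x (pres_gen (fun=> False) g) = mmap N (tagged g).1 (h (tagged g).2).
Proof. exact: pres_lift_gen. Qed.
End FreeLift.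

Lemma freeF_projective : projective freeF.
Proof.
move=> M N e f e_surj.
pose h c (a : A c) : M c := projT1 (cid (e_surj c
  (f c (pres_gen (fun=> False) (existT _ c (idm c, a) : fgen c))))).
have hE c a : e c (h c a) = f c (pres_gen (fun=> False) (existT _ c (idm c, a) : fgen c)).
  by rewrite /h; case: cid.
exists (freeF_lift h) => x.
apply: (@presented_ext _ _ _ _ (e x \o freeF_lift h x) (f x)) => -[c [g a]].
rewrite [LHS]/= freeF_liftE /= mtr_nat hE -mtr_nat; congr (f x _).
by rewrite [LHS]pres_lift_gen /fgen_map /= compm1.
Qed.

Definition freeF_eps : modT freeF A := freeF_lift (fun c a => a).

Lemma freeF_eps_surj x a : exists p, freeF_eps x p = a.
Proof.
exists (pres_gen (fun=> False) (existT _ x (idm x, a) : fgen x)).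
by rewrite freeF_liftE /= mmap1.
Qed.

Definition free_ker x : {pred freeF x} := fun p => freeF_eps x p == 0.
Lemma free_ker_submod x : GRing.submod_closed (@free_ker x).
Proof.
split=> [|c a b]; rewrite !unfold_in ?linear0// => /eqP a0 /eqP b0.
by rewrite linearP a0 b0 scaler0 addr0.
Qed.
Lemma free_ker_stable x y (f : hom x y) p :
  p \in @free_ker x -> mmap freeF f p \in @free_ker y.
Proof. by rewrite !unfold_in => /eqP p0; rewrite mtr_nat p0 linear0. Qed.
Definition syzygy : modF k C := subF free_ker_submod free_ker_stable.
Definition syzygy_val : modT syzygy freeF := subF_val free_ker_submod free_ker_stable.
End FreeFunctor.

Lemma resolution_exists (k : pzRingType) (C : category) (A : modF k C) :
  inhabited (resolution A).
Proof.
pose Z := fix Z n := if n is n'.+1 then syzygy (Z n') else A.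
pose dfun n x : {linear freeF (Z n.+1) x -> freeF (Z n) x} :=
  syzygy_val (Z n) x \o freeF_eps (Z n.+1) x.
have dnat n x y (f : hom x y) a :
    dfun n y (mmap (freeF (Z n.+1)) f a) = mmap (freeF (Z n)) f (dfun n x a).
  apply: etrans (mtr_nat (syzygy_val (Z n)) f _).
  exact: congr1 (mtr_nat (freeF_eps (Z n.+1)) f a).
have exact0 n x p : freeF_eps (Z n) x p = 0 <-> exists q, p = dfun n x q.
  split=> [p0|[q ->]]; last first.
    by apply/eqP; exact: (valP (freeF_eps (Z n.+1) x q)).
  have pK : p \in @free_ker k C (Z n) x by rewrite unfold_in p0.
  have [q qE] := @freeF_eps_surj k C (Z n.+1) x
     (SubMod (subS := free_ker_submod (Z n) x) pK).
  by exists q; rewrite /dfun /= qE.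
constructor; refine (@Resolution k C A (fun n => freeF (Z n))
  (fun n => ModT (dnat n)) (freeF_eps A) _ (@freeF_eps_surj k C A) (exact0 0%N) _).
  by move=> n; apply: freeF_projective.
move=> n x p; rewrite -(exact0 n.+1); split=> [dp|ep]; first exact: val_inj.
by apply: etrans (congr1 (syzygy_val (Z n) x) ep) _; rewrite linear0.
Qed.

Lemma res_lift_exists (k : pzRingType) (C D : category) (phi : functor C D)
    (A : modF k D) (P : resolution (pull phi A)) (Q : resolution A) :
  inhabited (res_lift P Q).
Proof.
pose cyc (E : category) (M : modF k E) (R : resolution M) n :
    forall x, R n x -> Prop :=
  match n with
  | 0 => fun x p => res_e R x p = 0
  | m.+1 => fun x p => res_d R m x p = 0
  end.
have cycE E M (R : resolution M) n x p :
    cyc E M R n x p <-> exists q, p = res_d R n x q.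
  by case: n p => [|n] p; [apply: res_exact0|apply: res_exact].
pose good n (u : modT (P n) (pull phi (Q n))) :=
  forall x p, cyc _ _ P n x p -> cyc _ _ Q n (phi x) (u x p).
have dnat n x y (f : hom x y) a : res_d Q n (phi y) (mmap (pull phi (Q n.+1)) f a) =
    mmap (pull phi (Q n)) f (res_d Q n (phi x) a) by exact: mtr_nat.
have enat x y (f : hom x y) a : res_e Q (phi y) (mmap (pull phi (Q 0%N)) f a) =
    mmap (pull phi A) f (res_e Q (phi x) a) by exact: mtr_nat.
have unat n (u : modT (P n) (pull phi (Q n))) x y (f : hom x y) a :
    u y (res_d P n y (mmap (P n.+1) f a)) =
    mmap (pull phi (Q n)) f (u x (res_d P n x a)) by rewrite !mtr_nat.
have step n (u : modT (P n) (pull phi (Q n))) : good n u ->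
    exists u' : modT (P n.+1) (pull phi (Q n.+1)),
      forall x p, u x (res_d P n x p) = res_d Q n (phi x) (u' x p).
  move=> gu.
  have [|u' u'E] := @projective_lift k C (P n.+1) (pull phi (Q n.+1)) (pull phi (Q n))
    (@ModT k C (pull phi (Q n.+1)) (pull phi (Q n)) (fun x => res_d Q n (phi x)) (dnat n))
    (@ModT k C (P n.+1) (pull phi (Q n)) (fun x => u x \o res_d P n x) (unat n u))
    (@res_proj _ _ _ P n.+1); last by exists u' => x p; rewrite -[LHS]u'E.
  by move=> x p; apply/cycE/gu/cycE; exists p.
have good_step n (u : modT (P n) (pull phi (Q n)))
    (u' : modT (P n.+1) (pull phi (Q n.+1))) : (forall x p, u x (res_d P n x p) = res_d Q n (phi x) (u' x p)) ->
    good n.+1 u'.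
  by move=> uu' x p /= dp; rewrite -uu' dp linear0.
have [u0 u0E] : exists u0 : modT (P 0%N) (pull phi (Q 0%N)),
    forall x p, res_e Q (phi x) (u0 x p) = res_e P x p.
  have [|u0 u0E] := @projective_lift k C (P 0%N) (pull phi (Q 0%N)) (pull phi A)
    (@ModT k C (pull phi (Q 0%N)) (pull phi A) (fun x => res_e Q (phi x)) enat)
    (res_e P) (@res_proj _ _ _ P 0%N); last by exists u0.
  by move=> x p; have [q <-] := res_surj Q (res_e P x p); exists q.
have good0 : good 0%N u0 by move=> x p /= ep; rewrite u0E.
pose U := fix U n : {u : modT (P n) (pull phi (Q n)) | good n u} :=
  match n with
  | 0 => exist _ u0 good0
  | m.+1 => let s := cid (step m (projT1 (U m)) (projT2 (U m))) in
            exist _ (projT1 s) (good_step m _ _ (projT2 s))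
  end.
constructor; exists (fun n => projT1 (U n)) => [n x p|x p]; last exact: u0E.
by rewrite /=; case: cid => u' /= ->.
Qed.

(* Main.v *)
From HB Require Import structures.
From mathcomp Require Import all_boot all_order all_algebra boolp functions.
Require Import Defs.

(** A double complex compares P (x) beta^*F with Q (x) F through beta^*Q (x) W, where W
    is a projective resolution of beta^*F; this works as soon as, for every free functor
    M on gr, beta^*M (x) W has no homology in positive degrees and beta^*M (x) beta^*F is
    M (x) F.

    To see this, let s : c -> n and consider the maps t : n * ... * n * c -> n (N copies
    of n) that are s on c and either the identity or trivial on each copy of n.  If F has
    degree < N, the alternating sum of the F(t) vanishes.  Every t but the one that is
    trivial on all the copies is the retraction of a morphism of S_c(gr), natural in
    (n, s), and so acts on beta^*M (x) W like the identity; the signs of these t add up to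
    -1.  As W is projective, the vanishing of the sum lifts to W up to homotopy.  So the
    identity of beta^*M (x) W is homotopic to the contribution of the last t, which
    factors through c and hence through a complex L (x) W with L free on S_c(gr)^op.

    An analytic functor is the increasing union of subfunctors for which the sums above
    vanish for large N, and projective functors are flat, which gives the general case. *)

Set Implicit Arguments.
Unset Strict Implicit.
Unset Printing Implicit Defensive.

Import GRing.Theory.
Local Open Scope ring_scope.

(** * Retractions of free groups *)

Local Notation cp := gr_copair.
Local Notation gid n := (idfun : grhom n n).

Lemma copair_comp m n p q (h : grhom p q) (f : grhom m p) (g : grhom n p) :
  grcomp h (cp f g) = cp (grcomp h f) (grcomp h g).
Proof.
by apply: gr_sum_ext; rewrite -grcompA ?gr_copair_inl ?gr_copair_inr.
Qed.

Lemma copair_id m n : cp (gr_inl m n) (gr_inr m n) = gid (m + n).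
Proof. by apply: gr_sum_ext; rewrite grcomp1m ?gr_copair_inl ?gr_copair_inr. Qed.

Definition gr_sum m n m' n' (f : grhom m n) (g : grhom m' n') :
    grhom (m + m') (n + n') :=
  cp (grcomp (gr_inl n n') f) (grcomp (gr_inr n n') g).

Lemma copair_sum m n m' n' p (f : grhom m n) (g : grhom m' n') (u : grhom n p)
    (v : grhom n' p) :
  grcomp (cp u v) (gr_sum f g) = cp (grcomp u f) (grcomp v g).
Proof. by rewrite copair_comp !grcompA gr_copair_inl gr_copair_inr. Qed.

Lemma gr_sum_comp m n p m' n' p' (f : grhom n p) (g : grhom m n)
    (f' : grhom n' p') (g' : grhom m' n') :
  gr_sum (grcomp f g) (grcomp f' g') = grcomp (gr_sum f f') (gr_sum g g').
Proof. by rewrite copair_sum /gr_sum !grcompA. Qed.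

Lemma gr_sum_id m n : gr_sum (gid m) (gid n) = gid (m + n).
Proof. by rewrite /gr_sum !grcompm1 copair_id. Qed.

(** A complement [w] of [u] that [v] kills suffices: [v] composed with [cp u w] is then the
    projection of m * t onto m, and [phi] inverts [cp u w]. *)
Lemma is_split_copair m n t (u : grhom m n) (v : grhom n m) (w : grhom t n)
    (phi : grhom n (m + t)) :
  grcomp (cp u w) phi = gid n -> grcomp phi (cp u w) = gid (m + t) ->
  grcomp v u = gid m -> grcomp v w = gr_triv t m -> is_split u v.
Proof.
move=> h1 h2 vu vw; exists t, phi, (cp u w); split=> //.
  by rewrite -[u in LHS](gr_copair_inl u w) grcompA h2 grcomp1m.
rewrite /gr_proj; apply/esym.
by rewrite -vu -vw -copair_comp -grcompA h1 grcompm1.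
Qed.

(** The converse of [is_split_copair]: the complement is the restriction of the inverse isomorphism
    to the factor [t]. *)
Lemma is_splitE m n (u : grhom m n) (v : grhom n m) : is_split u v ->
  exists t (w : grhom t n) (phi : grhom n (m + t)),
    [/\ grcomp (cp u w) phi = gid n, grcomp phi (cp u w) = gid (m + t),
     grcomp v u = gid m & grcomp v w = gr_triv t m].
Proof.
move=> [t [phi [psi [psiK phiK phiu ->]]]].
have psiE : psi = cp u (grcomp psi (gr_inr m t)).
  apply: gr_sum_ext; rewrite ?gr_copair_inl ?gr_copair_inr //.
  by rewrite -phiu grcompA psiK grcomp1m.
exists t, (grcomp psi (gr_inr m t)), phi; split.
- by rewrite -psiE.
- by rewrite -psiE.
- by rewrite -grcompA phiu gr_copair_inl.
- by rewrite -grcompA [grcomp phi _]grcompA phiK grcomp1m gr_copair_inr.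
Qed.

Lemma is_split_sum m n m' n' (u : grhom m n) v (u' : grhom m' n') v' :
  is_split u v -> is_split u' v' -> is_split (gr_sum u u') (gr_sum v v').
Proof.
move=> /is_splitE[t [w [phi [h1 h2 vu vw]]]] /is_splitE[t' [w' [phi' [h1' h2' vu' vw']]]].
(* [mid] and [mid'] are the mutually inverse reorderings of the four factors that bring the two
   complements together. *)
pose mid : grhom ((m + t) + (m' + t')) ((m + m') + (t + t')) :=
  cp (gr_sum (gr_inl m m') (gr_inl t t')) (gr_sum (gr_inr m m') (gr_inr t t')).
pose mid' : grhom ((m + m') + (t + t')) ((m + t) + (m' + t')) :=
  cp (gr_sum (gr_inl m t) (gr_inl m' t')) (gr_sum (gr_inr m t) (gr_inr m' t')).
have K1 : grcomp mid mid' = gid _.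
  rewrite /mid /mid' copair_comp !copair_sum /gr_sum !gr_copair_inl !gr_copair_inr.
  by rewrite -!copair_comp !copair_id !grcompm1 copair_id.
have K2 : grcomp mid' mid = gid _.
  rewrite /mid /mid' copair_comp !copair_sum /gr_sum !gr_copair_inl !gr_copair_inr.
  by rewrite -!copair_comp !copair_id !grcompm1 copair_id.
have E : cp (gr_sum u u') (gr_sum w w') = grcomp (gr_sum (cp u w) (cp u' w')) mid'.
  rewrite /mid' copair_comp -!gr_sum_comp.
  by rewrite !gr_copair_inl !gr_copair_inr.
apply: (@is_split_copair _ _ _ _ _ (gr_sum w w') (grcomp mid (gr_sum phi phi'))).
- by rewrite E -grcompA [grcomp mid' _]grcompA K2 grcomp1m -gr_sum_comp h1 h1' gr_sum_id.
- by rewrite E -grcompA [grcomp (gr_sum phi _) _]grcompA -gr_sum_comp h2 h2' gr_sum_id grcomp1m K1.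
- by rewrite -gr_sum_comp vu vu' gr_sum_id.
- rewrite -gr_sum_comp vw vw' /gr_sum !gr_triv_comp.
  by apply: gr_sum_ext; rewrite ?gr_copair_inl ?gr_copair_inr gr_comp_triv.
Qed.

Lemma is_split_inl n p (r : grhom p n) : is_split (gr_inl n p) (cp (gid n) r).
Proof.
(* The complement of n in n * p is the graph of x |-> r(x)^-1 x. *)
pose g (b : bool) : grhom p (n + p) :=
  free_lift (fun i => ((if b then gr_inl n p (r (gen i))
                        else (gr_inl n p (r (gen i)))^-1) * gr_inr n p (gen i))%g).
have g_gen b i : g b (gen i) = ((if b then gr_inl n p (r (gen i))
      else (gr_inl n p (r (gen i)))^-1) * gr_inr n p (gen i))%g.
  exact: free_lift_gen.
have gE b q (h : grhom (n + p) q) i : grcomp h (g b) (gen i) =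
    ((if b then grcomp h (gr_inl n p) (r (gen i))
      else (grcomp h (gr_inl n p) (r (gen i)))^-1) * grcomp h (gr_inr n p) (gen i))%g.
  transitivity (h (g b (gen i))) => //; rewrite g_gen gmulfM.
  by case: b => //; rewrite gmulfV.
apply: (@is_split_copair _ _ _ _ _ (g false) (cp (gr_inl n p) (g true))).
- apply: gr_sum_ext; first by rewrite -grcompA !gr_copair_inl grcomp1m.
  rewrite -grcompA gr_copair_inr grcomp1m; apply: grhom_ext => i.
  by rewrite gE gr_copair_inl gr_copair_inr g_gen mulgA mulgV mul1g.
- apply: gr_sum_ext; first by rewrite -grcompA !gr_copair_inl grcomp1m.
  rewrite -grcompA gr_copair_inr grcomp1m; apply: grhom_ext => i.
  by rewrite gE gr_copair_inl gr_copair_inr g_gen mulgA mulVg mul1g.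
- by rewrite gr_copair_inl.
- apply: grhom_ext => i.
  by rewrite gE gr_copair_inl gr_copair_inr mulVg [RHS]free_lift_gen.
Qed.

Lemma is_split_inr n p : is_split (gr_inr n p) (cp (gr_triv n p) (gid p)).
Proof.
apply: (@is_split_copair _ _ _ _ _ (gr_inl n p) (cp (gr_inr p n) (gr_inl p n))).
- by rewrite copair_comp gr_copair_inl gr_copair_inr copair_id.
- by rewrite copair_comp gr_copair_inl gr_copair_inr copair_id.
- by rewrite gr_copair_inr.
- by rewrite gr_copair_inl.
Qed.

Definition sc_inl n p (r : grhom p n) : schom n (n + p) := ScHom (is_split_inl r).
Definition sc_inr n p : schom p (n + p) := ScHom (is_split_inr n p).
Definition sc_sum m n m' n' (f : schom m n) (g : schom m' n') :
    schom (m + m') (n + n') :=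
  ScHom (is_split_sum (sc_split f) (sc_split g)).

Lemma sc_sum1 m n : sc_sum (scid m) (scid n) = scid (m + n).
Proof. by apply: schom_eq; rewrite /= gr_sum_id. Qed.

Lemma sc_sumM m n p m' n' p' (f : schom n p) (g : schom m n)
    (f' : schom n' p') (g' : schom m' n') :
  sc_sum (sccomp f g) (sccomp f' g') = sccomp (sc_sum f f') (sc_sum g g').
Proof. by apply: schom_eq; rewrite /= gr_sum_comp. Qed.

(** * Alternating sums over maps from copies of n to n *)

Fixpoint copies (N n a : nat) : nat := if N is N'.+1 then (n + copies N' n a)%N else a.

Fixpoint copies_map (N a m n : nat) (f : schom m n) : schom (copies N m a) (copies N n a) :=
  if N is N'.+1 then sc_sum f (copies_map N' a f) else scid a.

Definition copiesF (N a : nat) : functor Sc_gr Sc_gr.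
Proof.
refine (@Functor Sc_gr Sc_gr (fun n => copies N n a) (fun m n f => copies_map N a f) _ _).
- by move=> n; elim: N => //= N ->; rewrite sc_sum1.
- move=> m n p f g; elim: N => /= [|N ->]; first by rewrite sccompm1.
  by rewrite sc_sumM.
Defined.

(* The inclusion of a, with the retraction that kills the copies of n. *)
Fixpoint rho (N n a : nat) : schom a (copies N n a) :=
  if N is N'.+1 then sccomp (sc_inr n _) (rho N' n a) else scid a.

(** [copies_map N a f] is the identity on the factor [a]. The naturality of [rhoT] and the
    well-definedness of [push] rest on this. *)
Lemma rho_nat (N : nat) a m n (f : schom m n) : sccomp (copies_map N a f) (rho N m a) = rho N n a.
Proof.
elim: N => /= [|N IH]; first by rewrite sccompm1.
rewrite -IH !sccompA; congr sccomp; apply: schom_eq => /=.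
  by rewrite gr_copair_inr.
by rewrite copair_sum copair_comp gr_comp_triv gr_triv_comp grcompm1 grcomp1m.
Qed.

(** Unfolded, this is a sum over the subsets of the N copies: t is [s] on [a], [f] on the copies of
    the subset and trivial on the others, with sign -1 to the size of the subset, as in a
    cross-effect. *)
Fixpoint altsum (V : zmodType) (N m a n : nat) (f : grhom m n) (s : grhom a n) :
    (grhom (copies N m a) n -> V) -> V :=
  match N return (grhom (copies N m a) n -> V) -> V with
  | 0 => fun Phi => Phi s
  | N'.+1 => fun Phi => altsum f s (fun t => Phi (cp (gr_triv m n) t)) -
                        altsum f s (fun t => Phi (cp f t))
  end.

(** The part of [altsum] for the identity whose maps are not trivial on all copies. Each such map
    retracts the inclusion of the outermost copy on which it is the identity; the recursion peels
    off the trivial copies before it. *)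
Fixpoint retsum (V : zmodType) (N a n : nat) (s : grhom a n) : (schom n (copies N n a) -> V) -> V :=
  match N return (schom n (copies N n a) -> V) -> V with
  | 0 => fun=> 0
  | N'.+1 => fun Phi => retsum s (fun t => Phi (sccomp (sc_inr n (copies N' n a)) t)) -
                        altsum (gid n) s (fun t => Phi (sc_inl t))
  end.

Section Altsum.
Variable V : zmodType.

(** Both sums run over the same choices, so their terms can be compared one copy at a time. With
    [retsum_rel], this reduces naturality to finding an invariant [R] preserved when a copy is
    added. *)
Lemma altsum_rel N m a n (f : grhom m n) (s : grhom a n) m' a' n' (f' : grhom m' n')
    (s' : grhom a' n') (R : forall N, grhom (copies N m a) n -> grhom (copies N m' a') n' -> Prop)
    (Phi : grhom (copies N m a) n -> V) (Phi' : grhom (copies N m' a') n' -> V) :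
  R 0 s s' ->
  (forall N t t', R N t t' ->
     R N.+1 (cp (gr_triv m n) t) (cp (gr_triv m' n') t') /\ R N.+1 (cp f t) (cp f' t')) ->
  (forall t t', R N t t' -> Phi t = Phi' t') ->
  altsum f s Phi = altsum f' s' Phi'.
Proof.
move=> R0 RS; elim: N Phi Phi' => /= [|N IH] Phi Phi' PP; first exact: PP.
by congr (_ - _); apply: IH => t t' tt'; apply: PP; case: (RS _ _ _ tt').
Qed.

Lemma retsum_rel N a n n' a' (s : grhom a n) (s' : grhom a' n')
    (R : forall N, grhom (copies N n a) n -> grhom (copies N n' a') n' -> Prop)
    (RR : forall N, schom n (copies N n a) -> schom n' (copies N n' a') -> Prop)
    (Phi : schom n (copies N n a) -> V) (Phi' : schom n' (copies N n' a') -> V) :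
  R 0 s s' ->
  (forall N t t', R N t t' ->
     R N.+1 (cp (gr_triv n n) t) (cp (gr_triv n' n') t') /\ R N.+1 (cp (gid n) t) (cp (gid n') t')) ->
  (forall N t t', R N t t' -> RR N.+1 (sc_inl t) (sc_inl t')) ->
  (forall N t t', RR N t t' -> RR N.+1 (sccomp (sc_inr n _) t) (sccomp (sc_inr n' _) t')) ->
  (forall t t', RR N t t' -> Phi t = Phi' t') ->
  retsum s Phi = retsum s' Phi'.
Proof.
move=> R0 RS RRl RRr; elim: N Phi Phi' => //= N IH Phi Phi' PP.
congr (_ - _).
  by apply: IH => t t' tt'; apply: PP; apply: RRr.
by apply: (@altsum_rel _ _ _ _ _ _ _ _ _ _ _ R) => // t t' tt'; apply: PP; apply: RRl.
Qed.

Lemma eq_altsum N m a n (f : grhom m n) (s : grhom a n) (Phi Phi' : grhom (copies N m a) n -> V) :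
  Phi =1 Phi' -> altsum f s Phi = altsum f s Phi'.
Proof. by move=> /funext ->. Qed.

Lemma altsum_post N m a n p (h : grhom n p) (f : grhom m n) (s : grhom a n)
    (Phi : grhom (copies N m a) p -> V) :
  altsum f s (fun t => Phi (grcomp h t)) = altsum (grcomp h f) (grcomp h s) Phi.
Proof.
apply: (altsum_rel (R := fun N t t' => grcomp h t = t')) => //.
- by move=> N' t _ <-; rewrite !copair_comp gr_triv_comp.
- by move=> t _ <-.
Qed.

Lemma raddf_altsum (W : zmodType) (g : {additive V -> W}) N m a n (f : grhom m n)
    (s : grhom a n) (Phi : grhom (copies N m a) n -> V) :
  g (altsum f s Phi) = altsum f s (fun t => g (Phi t)).
Proof. by elim: N Phi => //= N IH Phi; rewrite raddfB !IH. Qed.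

Lemma raddf_retsum (W : zmodType) (g : {additive V -> W}) N a n
    (s : grhom a n) (Phi : schom n (copies N n a) -> V) :
  g (retsum s Phi) = retsum s (fun t => g (Phi t)).
Proof.
elim: N Phi => [|N IH] Phi /=; first by rewrite raddf0.
by rewrite raddfB IH raddf_altsum.
Qed.

(** All signs on [N.+1] copies add up to 0, and the omitted choice, trivial on every copy, has sign
    1. With no copy at all the sum would be empty, hence the successor. *)
Lemma retsum_cst N a n (s : grhom a n) (v : V) :
  retsum s (fun _ : schom n (copies N.+1 n a) => v) = - v.
Proof.
elim: N => [|N IH] /=; first by rewrite sub0r.
by rewrite -[retsum s _ - _]/(retsum s (fun _ : schom n (copies N.+1 n a) => v)) IH subrr subr0.
Qed.

(* Among the t summed over by altsum, all but the one killing every copy of n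
   are retractions. *)
Lemma altsum_retsum N a n (s : grhom a n) (Phi : grhom (copies N n a) n -> V) :
  altsum (gid n) s Phi =
  retsum s (fun t => Phi (sc_ret t)) + Phi (grcomp s (sc_ret (rho N n a))).
Proof.
elim: N Phi => [|N IH] Phi /=; first by rewrite add0r grcompm1.
rewrite IH addrAC; congr (_ + _); last first.
  by rewrite copair_comp grcompm1 !copair_comp !gr_triv_comp.
congr (_ - _); congr retsum; apply: funext => t.
by rewrite copair_comp gr_triv_comp grcompm1.
Qed.

(** Identities and trivial maps commute with [sc_ret f], so the map built from [s] and the one built
    from its image under [sc_ret f] form a square with f and its copies. This gives the naturality
    of [retsumT]. *)
Lemma retsum_nat N a m n (f : schom m n) (s : grhom a n)
    (Phi : schom m (copies N n a) -> V) :
  retsum s (fun t => Phi (sccomp t f)) =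
  retsum (grcomp (sc_ret f) s) (fun t => Phi (sccomp (copies_map N a f) t)).
Proof.
pose R N (t : grhom (copies N n a) n) (t' : grhom (copies N m a) m) :=
  grcomp (sc_ret f) t = grcomp t' (sc_ret (copies_map N a f)).
apply: (retsum_rel (R := R)
  (RR := fun N t t' => sccomp t f = sccomp (copies_map N a f) t')) => [||||t t' -> //].
- by rewrite /R /= grcompm1.
- move=> N' t t' tt'; rewrite /R /= !copair_sum !copair_comp tt'.
  by rewrite gr_triv_comp gr_comp_triv grcompm1 grcomp1m.
- move=> N' t t' tt'; apply: schom_eq => /=.
    by rewrite gr_copair_inl.
  by rewrite copair_sum copair_comp -tt' grcompm1 grcomp1m.
- move=> N' t t' tt'; rewrite -sccompA tt' !sccompA; congr sccomp.
  apply: schom_eq => /=; first by rewrite gr_copair_inr.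
  by rewrite copair_sum copair_comp gr_triv_comp gr_comp_triv grcompm1 grcomp1m.
Qed.

(** Each map of the sum restricts to [s] on the factor [a]. *)
Lemma retsum_sec N a n (s : grhom a n) (Phi : grhom a n -> V) :
  retsum s (fun t : schom n (copies N n a) => Phi (grcomp (sc_ret t) (sc_sec (rho N n a)))) =
  retsum s (fun _ : schom n (copies N n a) => Phi s).
Proof.
pose R N (t t' : grhom (copies N n a) n) := grcomp t (sc_sec (rho N n a)) = s.
apply: (retsum_rel (R := R)
  (RR := fun N t t' => grcomp (sc_ret t) (sc_sec (rho N n a)) = s)) => [||||t t' -> //].
- by rewrite /R /= grcompm1.
- by move=> N' t t' tt'; rewrite /R /= !grcompA !gr_copair_inr.
- by move=> N' t t' tt' /=; rewrite !grcompA !gr_copair_inr.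
- move=> N' t t' tt' /=.
  by rewrite -grcompA (grcompA (cp _ _)) gr_copair_inr grcomp1m.
Qed.

End Altsum.

(** * Polynomial and analytic functors *)

Section NaturalTransformations.
Variables (k : pzRingType) (C : category).

Definition modT_id (M : modF k C) : modT M M :=
  @ModT k C M M (fun=> idfun) (fun _ _ _ _ => erefl).

Lemma modT_sub_nat (M N : modF k C) (f g : modT M N) x y (h : @hom C x y) a :
  (f y \- g y) (mmap M h a) = mmap N h ((f x \- g x) a).
Proof. by rewrite /= !mtr_nat linearB. Qed.
Definition modT_sub (M N : modF k C) (f g : modT M N) : modT M N :=
  @ModT k C M N (fun x => f x \- g x : {linear M x -> N x}) (modT_sub_nat f g).

Lemma modT_add_nat (M N : modF k C) (f g : modT M N) x y (h : @hom C x y) a :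
  (f y \+ g y) (mmap M h a) = mmap N h ((f x \+ g x) a).
Proof. by rewrite /= !mtr_nat linearD. Qed.
Definition modT_add (M N : modF k C) (f g : modT M N) : modT M N :=
  @ModT k C M N (fun x => f x \+ g x : {linear M x -> N x}) (modT_add_nat f g).

Lemma modT_comp_nat (M N L : modF k C) (g : modT N L) (f : modT M N) x y
    (h : @hom C x y) a : (g y \o f y) (mmap M h a) = mmap L h ((g x \o f x) a).
Proof. by rewrite /= !mtr_nat. Qed.
Definition modT_comp (M N L : modF k C) (g : modT N L) (f : modT M N) : modT M L :=
  ModT (modT_comp_nat g f).
End NaturalTransformations.

Lemma mmap_comp_op (k : pzRingType) (F : modF k (op gr)) m n p (g : grhom n p)
    (f : grhom m n) (x : F p) :
  mmap F (f : @hom (op gr) n m) (mmap F (g : @hom (op gr) p n) x) =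
  mmap F (grcomp g f : @hom (op gr) p m) x.
Proof. by rewrite -mmapM. Qed.

Definition gr_kill p (A : pred 'I_p) : grhom p p :=
  free_lift (fun i => if A i then 1%g else gen i).

Lemma copair_kill m n p (f : grhom m p) (g : grhom n p) (A : pred 'I_(m + n)) :
  grcomp (cp f g) (gr_kill A) =
  cp (grcomp f (gr_kill (A \o lshift n))) (grcomp g (gr_kill (A \o @rshift m n))).
Proof.
have killE q (B : pred 'I_q) i : gr_kill B (gen i) = if B i then 1%g else gen i.
  exact: free_lift_gen.
have E q r t (h : grhom r t) (h' : grhom q r) x : grcomp h h' x = h (h' x) by [].
have cpE i : cp f g (gen i) = match fintype.split i with
                              | inl j => f (gen j)
                              | inr j => g (gen j)
                              end by exact: free_lift_gen.
apply: grhom_ext => i; rewrite E killE [RHS]free_lift_gen.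
case: (split_ordP i) => j ->; rewrite E killE /=.
  by case: ifP => _; rewrite ?gmulf1 // cpE -[lshift n j]/(unsplit (inl j)) unsplitK.
by case: ifP => _; rewrite ?gmulf1 // cpE -[rshift m j]/(unsplit (inr j)) unsplitK.
Qed.

Lemma kill_all m n (f : grhom m n) (A : pred 'I_m) :
  (forall i, A i) -> grcomp f (gr_kill A) = gr_triv m n.
Proof.
move=> AT; suff -> : gr_kill A = gr_triv m m by rewrite gr_triv_comp.
by apply: grhom_ext => i; rewrite /= !free_lift_gen AT.
Qed.

Lemma kill_none m n (f : grhom m n) (A : pred 'I_m) :
  (forall i, A i = false) -> grcomp f (gr_kill A) = f.
Proof.
by move=> AT; apply: grhom_ext => i; rewrite /= free_lift_gen AT.
Qed.

(** The colour classes split the free group into d + 1 free factors. Omitting one factor lands among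
    generators that killing its colour fixes, so the hypothesis gives vanishing under each
    [omit]. *)
Lemma polynomial_kill (k : pzRingType) d (F : modF k (op gr)) p (c : 'I_p -> 'I_d.+1)
    (z : F p) : polynomial_le d F ->
  (forall i, mmap F (gr_kill [pred x | c x == i] : @hom (op gr) p p) z = 0) -> z = 0.
Proof.
move=> polF zK; pose A i := [set x | c x == i]; pose a i := #|A i|.
have xA x : x \in A (c x) by rewrite inE.
pose val i : 'I_(a i) -> 'I_p := @enum_val _ (mem (A i)).
have c_val i y : c (@val i y) = i by have /[!inE] /eqP := enum_valP y.
have val_Rank i y : @val _ (tagnat.sig2 (@tagnat.Rank _ a i y)) = @val i y.
  exact: (congr1 (fun q => @val (tag q) (tagged q)) (tagnat.rankK (Tagged _ y))).
(* [th] lists the generators class by class; its right inverse [ps] makes F(th) injective, F being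
   contravariant. *)
pose th : grhom (\sum_j a j)%N p := free_lift (fun t => gen (@val _ (tagnat.sig2 t))).
pose ps : grhom p (\sum_j a j)%N :=
  free_lift (fun x => gen (@tagnat.Rank _ a (c x) (enum_rank_in (xA x) x))).
have thK : grcomp th ps = gid p.
  apply: grhom_ext => x; rewrite /= !free_lift_gen val_Rank; congr gen.
  by rewrite /val enum_rankK_in.
suff th0 : mmap F (th : @hom (op gr) p _) z = 0.
  have := mmap_comp_op th ps z; rewrite th0 linear0 thK => E.
  exact: etrans (esym (@mmap1 k (op gr) F p z)) (esym E).
apply: polF => i; rewrite mmap_comp_op.
suff -> : grcomp th (omit a i) =
    grcomp (gr_kill [pred x | c x == i]) (grcomp th (omit a i)).
  by rewrite -mmap_comp_op zK linear0.
apply: grhom_ext => s; rewrite /= !free_lift_gen /= val_Rank ifF //.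
by rewrite c_val eq_sym (negPf (neq_lift _ _)).
Qed.

(* The innermost copy of m has the same colour as a. *)
Fixpoint colour (N m a : nat) : 'I_(copies N m a) -> nat :=
  match N return 'I_(copies N m a) -> nat with
  | 0 => fun=> 0%N
  | N'.+1 => fun x => match fintype.split x with inl _ => N' | inr y => colour y end
  end.

(** Once a whole copy is killed, the terms that are [f] and trivial on it coincide and have opposite
    signs. [P] may select several colours, since colours get merged in the application. *)
Lemma altsum_kill (V : zmodType) N m a n (f : grhom m n) (s : grhom a n)
    (Phi : grhom (copies N m a) n -> V) (P : pred nat) i : (i < N)%N -> P i ->
  altsum f s (fun t => Phi (grcomp t (gr_kill (P \o @colour N m a)))) = 0.
Proof.
elim: N Phi => [//|N IH] Phi; rewrite ltnS leq_eqVlt => lti Pi /=.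
have E (h : grhom m n) t :
    grcomp (cp h t) (gr_kill (P \o @colour N.+1 m a)) =
    cp (if P N then gr_triv m n else h) (grcomp t (gr_kill (P \o @colour N m a))).
  rewrite copair_kill; congr gr_copair.
    case: ifPn => PN.
      by apply: kill_all => j /=; rewrite -[lshift _ j]/(unsplit (inl j)) unsplitK.
    by apply: kill_none => j /=;
       rewrite -[lshift _ j]/(unsplit (inl j)) unsplitK (negPf PN).
  congr grcomp; congr gr_kill; apply: funext => j /=.
  by rewrite -[rshift _ j]/(unsplit (inr j)) unsplitK.
under eq_altsum do rewrite E.
under [X in _ - X]eq_altsum do rewrite E.
have [PN|PN] := boolP (P N); first by rewrite subrr.
case/orP: lti => [/eqP iN|ltiN]; first by rewrite iN (negPf PN) in Pi.
by rewrite (IH (fun t => Phi (cp _ t))) // (IH (fun t => Phi (cp _ t))) // subrr.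
Qed.

(** * Small elements and the filtration they define *)

Section Small.
Variables (k : pzRingType).

(* The condition is imposed for all M >= N so that it is monotone in N. *)
Definition small_elt (F : modF k (op gr)) N n (x : F n) := forall M m a
  (f : grhom m n) (s : grhom a n), (N <= M)%N ->
  altsum f s (fun t : grhom (copies M m a) n =>
                mmap F (t : @hom (op gr) n (copies M m a)) x) = 0.

Lemma polynomial_small d (F : modF k (op gr)) n (x : F n) :
  polynomial_le d F -> small_elt d.+1 x.
Proof.
move=> polF M m a f s ltdM.
(* Colours above d are merged into d, which leaves d + 1 classes; as M > d, each of them contains a
   whole copy. *)
apply: (polynomial_kill (c := fun y => inord (minn (colour y) d))) polF _ => i.
rewrite raddf_altsum /=.
rewrite (eq_altsum _ _ (fun t => mmap_comp_op t _ x)).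
apply: (altsum_kill _ _ (fun t => mmap F (t : @hom (op gr) n (copies M m a)) x)
         (P := fun j => inord (minn j d) == i) (i := i)).
  exact: leq_trans (ltn_ord i) ltdM.
have /minn_idPl -> : (i <= d)%N by exact: (ltn_ord i).
by rewrite inord_val.
Qed.

Lemma small_nat (F G : modF k (op gr)) (h : modT F G) N n (x : F n) :
  small_elt N x -> small_elt N (h n x).
Proof.
move=> sx M m a f s leNM.
rewrite (eq_altsum _ _ (fun t : grhom (copies M m a) n => esym (mtr_nat h (t : @hom (op gr) _ _) x))).
rewrite -(raddf_altsum (h (copies M m a))).
by apply: etrans (linear0 (h (copies M m a))); congr (h _ _); apply: sx.
Qed.

Lemma small_le (F : modF k (op gr)) N N' n (x : F n) :
  (N <= N')%N -> small_elt N x -> small_elt N' x.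
Proof. by move=> le sx M m a f s leM; apply: sx; apply: leq_trans leM. Qed.

Lemma altsum_lin (V : lmodType k) N m a n (f : grhom m n) (s : grhom a n) c
    (Phi Phi' : grhom (copies N m a) n -> V) :
  altsum f s (fun t => c *: Phi t + Phi' t) = c *: altsum f s Phi + altsum f s Phi'.
Proof.
elim: N Phi Phi' => //= N IH Phi Phi'.
by rewrite !IH scalerBr opprD addrACA.
Qed.

Lemma small_lin (F : modF k (op gr)) N n c (x y : F n) :
  small_elt N x -> small_elt N y -> small_elt N (c *: x + y).
Proof.
move=> sx sy M m a f s leNM; under eq_altsum do rewrite linearP.
by rewrite altsum_lin sx // sy // scaler0 addr0.
Qed.

Lemma small0 (F : modF k (op gr)) N n : small_elt N (0 : F n).
Proof.
move=> M m a f s _; under eq_altsum do rewrite linear0.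
by rewrite -(raddf_altsum (V := F n) \0 f s (fun=> 0)).
Qed.

Lemma small_mmap (F : modF k (op gr)) N m n (g : grhom m n) (x : F n) :
  small_elt N x -> small_elt N (mmap F (g : @hom (op gr) n m) x).
Proof.
move=> sx M p a f s leNM.
under eq_altsum do rewrite mmap_comp_op.
rewrite (altsum_post g f s (fun t => mmap F (t : @hom (op gr) n (copies M p a)) x)).
exact: sx.
Qed.

Definition smallN (F : modF k (op gr)) N n : {pred F n} := fun x => `[< small_elt N x >].
Arguments smallN : clear implicits.

Lemma smallN_submod F N n : GRing.submod_closed (smallN F N n).
Proof.
split=> [|c x y]; first exact/asboolP/small0.
by move=> /asboolP sx /asboolP sy; apply/asboolP/small_lin.
Qed.

Lemma smallN_stable F N n m (f : @hom (op gr) n m) x :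
  x \in smallN F N n -> mmap F f x \in smallN F N m.
Proof. by move=> /asboolP sx; apply/asboolP/small_mmap. Qed.

Definition smallF F N : modF k (op gr) :=
  @subF k (op gr) F (smallN F N) (smallN_submod F N) (@smallN_stable F N).
Definition smallF_val F N : modT (smallF F N) F :=
  @subF_val k (op gr) F (smallN F N) (smallN_submod F N) (@smallN_stable F N).

Lemma smallF_val_inj F N n : injective (smallF_val F N n).
Proof. exact: val_inj. Qed.

Lemma smallF_valP (F : modF k (op gr)) N n (x : F n) : small_elt N x -> exists y, smallF_val F N n y = x.
Proof.
move=> sx; have xS : x \in smallN F N n by apply/asboolP.
by exists (SubMod (subS := smallN_submod F N n) xS).
Qed.

(** The alternating sum can be computed in F, because the inclusion of the subfunctor is natural and
    injective. *)
Lemma smallF_small (F : modF k (op gr)) N n (x : smallF F N n) : small_elt N x.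
Proof.
move=> M m a f s leNM; apply: smallF_val_inj; rewrite linear0 raddf_altsum.
exact: (asboolP _ (valP x)).
Qed.

(* The elements lying in some smallF F N form a subfunctor U containing the image
   of every polynomial D j, so the identity of F factors through U. *)
Lemma analytic_small (F : modF k (op gr)) n (x : F n) : analytic F -> exists N, small_elt N x.
Proof.
move=> [J [D [c [polD [cocone colim]]]]].
pose U m : {pred F m} := fun y => `[< exists N, small_elt N y >].
have subU m : GRing.submod_closed (U m).
  split=> [|r y z]; first by apply/asboolP; exists 0%N; apply: small0.
  move=> /asboolP[N sy] /asboolP[N' sz]; apply/asboolP; exists (maxn N N').
  by apply: small_lin; apply: small_le; [apply: leq_maxl| |apply: leq_maxr|].
have stabU m p (f : @hom (op gr) m p) y : y \in U m -> mmap F f y \in U p.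
  by move=> /asboolP[N sy]; apply/asboolP; exists N; apply: small_mmap.
have cU j m y : c j m y \in U m.
  have [d pd] := polD j; apply/asboolP; exists d.+1; apply: small_nat.
  exact: polynomial_small.
pose e j := @subF_factor k (op gr) F U subU stabU (D j) (c j) (cU j).
have [|h [hE _]] := colim _ e.
  by move=> i j f m y; apply: val_inj; apply: cocone.
have [h0 [_ uniq]] := colim F c cocone.
pose v := @subF_val k (op gr) F U subU stabU.
pose vh := modT_comp v h.
have E : vh n x = @modT_id k (op gr) F n x.
  rewrite (uniq (@modT_id k (op gr) F)) // (uniq vh) // => j m y /=.
  by rewrite hE.
have /asboolP := valP (h n x).
by rewrite (_ : val _ = x).
Qed.

End Small.

(** * Flatness of projective functors *)

Definition exact_at (U : Type) (V W : zmodType) (f : U -> V) (g : V -> W) :=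
  forall v, g v = 0 -> exists u, v = f u.

Lemma presented_ind (k : pzRingType) (X : Type) (R : seq (k * X) -> Prop)
    (Q : presented R -> Prop) :
  Q 0 -> (forall p q, Q p -> Q q -> Q (p + q)) ->
  (forall r x, Q (r *: pres_gen R x)) -> forall p, Q p.
Proof.
move=> Q0 QD Qg p; have [w ->] := pres_genE p.
by elim: w => [|m w IH]; rewrite ?big_nil // big_cons; apply: QD.
Qed.

Section TensorBasics.
Variables (k : comPzRingType) (C : category).

Lemma tensor_ind (A : modF k (op C)) (B : modF k C) (Q : tensor A B -> Prop) :
  Q 0 -> (forall p q, Q p -> Q q -> Q (p + q)) ->
  (forall x (a : A x) (b : B x), Q (tens a b)) -> forall z, Q z.
Proof.
move=> Q0 QD Qt; apply: presented_ind => // r [x [a b]].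
have := Qt x (r *: a) b.
by rewrite (balZl (tens_balanced A B)).
Qed.

Lemma tens_mapl_mapr (A A' : modF k (op C)) (B B' : modF k C) (f : modT A A')
    (g : modT B B') z :
  tens_mapl B' f (tens_mapr A g z) = tens_mapr A' g (tens_mapl B f z).
Proof.
apply: (@tensor_ext _ _ _ _ _ (tens_mapl B' f \o tens_mapr A g)
         (tens_mapr A' g \o tens_mapl B f)) => x a b /=.
by rewrite !tens_maplE !tens_maprE !tens_maplE.
Qed.

Lemma tens_mapl_comp (A A' A'' : modF k (op C)) (B : modF k C) (f : modT A A')
    (g : modT A' A'') (h : modT A A'') z :
  (forall x a, h x a = g x (f x a)) ->
  tens_mapl B g (tens_mapl B f z) = tens_mapl B h z.
Proof.
move=> E; apply: (@tensor_ext _ _ _ _ _ (tens_mapl B g \o tens_mapl B f)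
         (tens_mapl B h)) => x a b /=.
by rewrite !tens_maplE E.
Qed.

Lemma tens_mapl_id (A : modF k (op C)) (B : modF k C) (f : modT A A) z :
  (forall x a, f x a = a) -> tens_mapl B f z = z.
Proof.
move=> E; apply: (@tensor_ext _ _ _ _ _ (tens_mapl B f) idfun) => x a b /=.
by rewrite tens_maplE E.
Qed.

Lemma tens_mapr_surj (A : modF k (op C)) (B B' : modF k C) (f : modT B B') :
  (forall x b, exists a, f x a = b) -> forall z, exists y, z = tens_mapr A f y.
Proof.
move=> fs; apply: tensor_ind => [|p q [y ->] [z ->]|x a b].
- by exists 0; rewrite linear0.
- by exists (y + z); rewrite linearD.
- by have [b' <-] := fs x b; exists (tens a b'); rewrite tens_maprE.
Qed.

Lemma tens_mapl_surj (A A' : modF k (op C)) (B : modF k C) (f : modT A A') :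
  (forall x b, exists a, f x a = b) -> forall z, exists y, z = tens_mapl B f y.
Proof.
move=> fs; apply: tensor_ind => [|p q [y ->] [z ->]|x a b].
- by exists 0; rewrite linear0.
- by exists (y + z); rewrite linearD.
- by have [a' <-] := fs x a; exists (tens a' b); rewrite tens_maplE.
Qed.

(** Lifting elements of B'' along [g] defines a map from A (x) B'' to the quotient of A (x) B' by
    the image of [f]: two lifts differ by an element of that image. Composed with [g] it is the
    quotient map, so the kernel of [g] lies in the image. *)
Lemma tens_mapr_right_exact (A : modF k (op C)) (B B' B'' : modF k C)
    (f : modT B B') (g : modT B' B'') :
  (forall x b, g x b = 0 <-> exists a, b = f x a) ->
  (forall x b, exists a, g x a = b) ->
  exact_at (tens_mapr A f) (tens_mapr A g).
Proof.
move=> fg gs; pose S : {pred tensor A B'} := fun z => `[< exists y, z = tens_mapr A f y >].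
have subS : GRing.submod_closed S.
  split=> [|c y z]; first by apply/asboolP; exists 0; rewrite linear0.
  move=> /asboolP[y' ->] /asboolP[z' ->]; apply/asboolP.
  by exists (c *: y' + z'); rewrite linearP.
have [hDl hDr hZl hZr hF] := tens_balanced A B'.
pose inv x b := projT1 (cid (gs x b)); have invK x b : g x (inv x b) = b.
  by rewrite /inv; case: cid.
have piE x a b b' : g x b = g x b' -> quot_pi subS (tens a b) = quot_pi subS (tens a b').
  move=> E; have [c Ec] : exists c, b - b' = f x c by apply/fg; rewrite linearB E subrr.
  apply/quot_piP/asboolP; exists (tens a c); rewrite tens_maprE -Ec hDr.
  by rewrite -[- b']scaleN1r hZr scaleN1r.
have bal : @balanced k C A B'' (quot_mod subS) (fun x a b => quot_pi subS (tens a (inv x b))).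
  split=> [x a a' b|x a b b'|x r a b|x r a b|x y h a b].
  - by rewrite hDl linearD.
  - by rewrite -linearD -hDr; apply: piE; rewrite linearD !invK.
  - by rewrite hZl linearZ.
  - by rewrite -linearZ -hZr; apply: piE; rewrite linearZ !invK.
  - by rewrite hF; apply: piE; rewrite mtr_nat !invK.
have E z : tens_lift bal (tens_mapr A g z) = quot_pi subS z.
  apply: (@tensor_ext _ _ _ _ _ (tens_lift bal \o tens_mapr A g)
    (@quot_pi _ _ _ subS)) => x a b /=.
  by rewrite tens_maprE tens_liftE; apply: piE; rewrite invK.
move=> z z0; have := E z; rewrite z0 linear0 => /esym.
rewrite -[RHS](linear0 (quot_pi subS)) => /quot_piP; rewrite subr0.
by move=> /asboolP.
Qed.

Definition flat (A : modF k (op C)) :=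
  forall (B B' B'' : modF k C) (f : modT B B') (g : modT B' B''),
    (forall x, exact_at (f x) (g x)) -> exact_at (tens_mapr A f) (tens_mapr A g).

(* In all uses L x is convertible to the free module on S x and j is the identity. *)
Section TensorGlue.
Variables (L : modF k (op C)) (S : C -> Type) (B : modF k C) (V : lmodType k).
Variable Smap : forall x y, @hom C x y -> S y -> S x.
Variable j : forall x, {linear L x -> @presented k (S x) (fun=> False)}.
Hypothesis j_nat : forall x y (f : @hom C x y) a,
  j x (mmap L (f : @hom (op C) y x) a) =
  pres_lift (@no_rel k _ _ (fun g => pres_gen (fun=> False) (Smap f g))) (j y a).
Variable phi : forall x, S x -> {linear B x -> V}.
Hypothesis phi_nat : forall x y (f : @hom C x y) g b,
  phi (Smap f g) b = phi g (mmap B f b).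

Definition glue_fun x (a : L x) (b : B x) : V :=
  pres_lift (@no_rel k _ _ (fun g => phi g b)) (j x a).

Lemma glue_balanced : balanced glue_fun.
Proof.
have glD x p q b (e := fun b => pres_lift (@no_rel k _ _ (fun g => @phi x g b))) :
  e b (p + q) = e b p + e b q by exact: linearD.
have glZ x r p b (e := fun b => pres_lift (@no_rel k _ _ (fun g => @phi x g b))) :
  e b (r *: p) = r *: e b p by exact: linearZ.
have gl0 x b (e := fun b => pres_lift (@no_rel k _ _ (fun g => @phi x g b))) :
  e b 0 = 0 by exact: linear0.
rewrite /glue_fun; split=> [x a a' b|x a b b'|x r a b|x r a b|x y f a b].
- by rewrite linearD glD.
- elim/presented_ind: (j x a) => [|p q Ep Eq|s g].
  + by rewrite !gl0 addr0.
  + by rewrite !glD Ep Eq addrACA.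
  + by rewrite !glZ !pres_lift_gen linearD scalerDr.
- by rewrite linearZ glZ.
- elim/presented_ind: (j x a) => [|p q Ep Eq|s g].
  + by rewrite !gl0 scaler0.
  + by rewrite !glD Ep Eq scalerDr.
  + by rewrite !glZ !pres_lift_gen linearZ /= !scalerA mulrC.
- rewrite j_nat; elim/presented_ind: (j y a) => [|p q Ep Eq|s g].
  + by rewrite linear0 !gl0.
  + by rewrite linearD !glD Ep Eq.
  + by rewrite linearZ /= !glZ !pres_lift_gen phi_nat.
Qed.

(** The first factor is pointwise free on the presheaf of sets [S], so a map out of the tensor
    product is determined by its values on generators, which must only be compatible with [Smap]. *)
Definition tens_glue : {linear tensor L B -> V} := tens_lift glue_balanced.

Lemma tens_glueE x (a : L x) g (b : B x) : j x a = pres_gen (fun=> False) g ->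
  tens_glue (tens a b) = phi g b.
Proof. by move=> jE; rewrite /tens_glue tens_liftE /glue_fun jE pres_lift_gen. Qed.

Lemma tens_glue_ind (Q : tensor L B -> Prop) :
  (forall x, injective (j x)) -> (forall x g, exists a, j x a = pres_gen (fun=> False) g) ->
  Q 0 -> (forall p q, Q p -> Q q -> Q (p + q)) ->
  (forall x (a : L x) g b, j x a = pres_gen (fun=> False) g -> Q (tens a b)) ->
  forall z, Q z.
Proof.
move=> j_inj j_surj Q0 QD Qt; have [hDl hDr hZl hZr hF] := tens_balanced L B.
apply: tensor_ind => // x a b; have [p jp] : exists p, p = j x a by exists (j x a).
elim/presented_ind: p a jp => [a|p q Ep Eq a|r g a].
- rewrite -[0](linear0 (j x)) => /j_inj <-.
  by have := hZl x 0 0 b; rewrite !scale0r => ->.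
- have jS p' : exists a, j x a = p'.
    elim/presented_ind: p' => [|_ _ [a1 <-] [a2 <-]|r g].
    + by exists 0; rewrite linear0.
    + by exists (a1 + a2); rewrite linearD.
    + by have [a' <-] := j_surj x g; exists (r *: a'); rewrite linearZ.
  have [[a1 E1] [a2 E2]] := (jS p, jS q).
  rewrite -E1 -E2 -linearD => /j_inj <-; rewrite hDl.
  by apply: QD; [apply: Ep|apply: Eq].
- have [a' E] := j_surj x g; rewrite -E -linearZ => /j_inj <-.
  by rewrite hZl -hZr; apply: Qt E.
Qed.
End TensorGlue.

Section FlatFree.
Variable A0 : modF k (op C).
Local Notation Fr := (freeF A0).
Local Notation I := {c : C & A0 c}.

(** By the co-Yoneda lemma the tensor product is the direct sum of the modules B (tag i); this is
    the inclusion of a summand, and [coord] below is the projection. *)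
Definition free_tens (B : modF k C) (i : I) (b : B (tag i)) : tensor Fr B :=
  @tens k C Fr B (tag i)
    (pres_gen (fun=> False) (existT _ (tag i) (@idm C (tag i), tagged i) : fgen A0 (tag i))) b.

Lemma free_tens_gen (B : modF k C) x (g : @fgen k (op C) A0 x) (b : B x) :
  @tens k C Fr B x (pres_gen (fun=> False) g) b =
  @free_tens B (existT _ (tag g) (tagged g).2) (mmap B ((tagged g).1 : @hom C x (tag g)) b).
Proof.
case: g => c [h a] /=; rewrite /free_tens -(balF (tens_balanced Fr B)) /=; congr tens.
by rewrite [RHS]pres_lift_gen /fgen_map /= comp1m.
Qed.

Lemma free_tensD B i b b' : @free_tens B i (b + b') = free_tens b + free_tens b'.
Proof. exact: (balDr (tens_balanced Fr B)). Qed.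

Lemma free_tens_ind (B : modF k C) (Q : tensor Fr B -> Prop) :
  Q 0 -> (forall p q, Q p -> Q q -> Q (p + q)) ->
  (forall i b, Q (@free_tens B i b)) -> forall z, Q z.
Proof.
move=> Q0 QD Qt; have [hDl hDr hZl hZr hF] := tens_balanced Fr B.
apply: tensor_ind => // x a b; elim/presented_ind: a.
- by have := hZl x 0 0 b; rewrite !scale0r => ->.
- by move=> p q Qp Qq; rewrite hDl; apply: QD.
- by move=> r g; rewrite hZl -hZr free_tens_gen.
Qed.

Section FreeTensLift.
Variables (B : modF k C) (V : lmodType k) (lam : forall i : I, {linear B (tag i) -> V}).

Definition free_tens_phi x (g : @fgen k (op C) A0 x) : {linear B x -> V} :=
  lam (existT _ (tag g) (tagged g).2) \o mmap B ((tagged g).1 : @hom C x (tag g)).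

Lemma free_tens_phi_nat x y (f : @hom C x y) (g : @fgen k (op C) A0 y) b :
  free_tens_phi (existT _ (tag g) (@comp (op C) _ _ _ f (tagged g).1, (tagged g).2) :
                   @fgen k (op C) A0 x) b =
  free_tens_phi g (mmap B f b).
Proof. by rewrite /= mmapM. Qed.

Definition free_tens_lift : {linear tensor Fr B -> V} :=
  tens_glue (j := fun x => idfun : {linear Fr x -> presented (fun=> False)})
    (fun x y f a => erefl) free_tens_phi_nat.

Lemma free_tens_liftE i b : free_tens_lift (@free_tens B i b) = lam i b.
Proof.
pose g : @fgen k (op C) A0 (tag i) := existT _ (tag i) (@idm C (tag i), tagged i).
apply: etrans (tens_glueE _ _ (g := g) _ _) _ => //.
by rewrite /= mmap1; case: i b @g.
Qed.
End FreeTensLift.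

(** A Kronecker delta. B (tag i) and B (tag j) are different types, so the diagonal case transports
    along a proof of i = j, obtained classically. *)
Definition coord_lam (B : modF k C) (j i : I) (b : B (tag i)) : B (tag j) :=
  match pselect (i = j) with
  | left e => eq_rect i (fun l : I => B (tag l)) b j e
  | right _ => 0
  end.

Fact coord_lam_linear B j i : linear (@coord_lam B j i).
Proof.
move=> r b b'; rewrite /coord_lam; case: pselect => [e|_]; last by rewrite scaler0 addr0.
by case: _ / e.
Qed.
HB.instance Definition _ B j i :=
  GRing.isLinear.Build k _ _ _ (@coord_lam B j i) (@coord_lam_linear B j i).

Definition coord B j : {linear tensor Fr B -> B (tag j)} :=
  free_tens_lift (fun i => @coord_lam B j i).

Lemma coord_free_tens B i b : coord B i (@free_tens B i b) = b.
Proof.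
rewrite /coord free_tens_liftE /= /coord_lam.
by case: pselect => [e|[]//]; rewrite (Prop_irrelevance e erefl).
Qed.

Lemma coord_free_tens_neq B i j b : i <> j -> coord B j (@free_tens B i b) = 0.
Proof.
by move=> ij; rewrite /coord free_tens_liftE /= /coord_lam; case: pselect.
Qed.

Lemma coord_nat B B' (f : modT B B') j z : coord B' j (tens_mapr Fr f z) = f _ (coord B j z).
Proof.
elim/free_tens_ind: z => [|p q|i b]; first by rewrite !linear0.
  by rewrite !linearD => -> ->.
rewrite tens_maprE -/(@free_tens B' i (f _ b)).
have [e|ij] := pselect (i = j); last by rewrite !coord_free_tens_neq ?linear0.
by rewrite -e !coord_free_tens.
Qed.

Lemma free_tens_decomp B z : exists l : seq {classic I},
  z = \sum_(i <- l) @free_tens B i (coord B i z).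
Proof.
(* Strengthened to all duplicate-free lists containing [l], so that the supports of two summands can
   be merged. *)
suff [l lP] : exists l : seq {classic I}, forall l', uniq l' -> {subset l <= l'} ->
    z = \sum_(i <- l') @free_tens B i (coord B i z).
  exists (undup l); apply: lP; first exact: undup_uniq.
  by move=> i; rewrite mem_undup.
have ft0 i : @free_tens B i 0 = 0.
  by have := free_tensD (0 : B (tag i)) 0; rewrite addr0 -{1}[@free_tens B i 0]addr0 => /addrI/esym.
elim/free_tens_ind: z => [|p q [l lP] [m mP]|i b].
- by exists [::] => l' _ _; rewrite big1 // => i _; rewrite linear0 ft0.
- exists (l ++ m) => l' ul' sl'.
  under eq_bigr do rewrite linearD free_tensD.
  rewrite big_split /= -lP // -?mP // => i il; apply: sl'; rewrite mem_cat il ?orbT //.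
- exists [:: i : {classic I}] => l' ul' sl'.
  rewrite (bigD1_seq (i : {classic I})) //=; last by apply: sl'; rewrite mem_head.
  rewrite coord_free_tens big1 ?addr0 // => j ji.
  rewrite coord_free_tens_neq ?ft0 // => e; by rewrite e eqxx in ji.
Qed.

(** Coordinates are natural in B, so the finitely many coordinates of an element of the kernel are
    lifted one by one. *)
Lemma free_flat : flat Fr.
Proof.
move=> B B' B'' f g fg z gz0; have [l ->] := free_tens_decomp z.
elim: l => [|i l [y IH]]; first by exists 0; rewrite big_nil linear0.
have [b bE] : exists b, coord B' i z = f _ b by apply: fg; rewrite -coord_nat gz0 linear0.
exists (@free_tens B i b + y); rewrite big_cons IH linearD; congr (_ + _).
by rewrite bE tens_maprE.
Qed.
End FlatFree.

(** A projective functor is a retract of the free functor that covers it, and flatness passes to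
    retracts. *)
Lemma projective_flat (A : modF k (op C)) : projective A -> flat A.
Proof.
move=> pA B B' B'' f g fg z gz0.
have [s sK] := pA _ _ (freeF_eps A) (@modT_id k (op C) A)
  (@freeF_eps_surj k (op C) A).
have [|y yE] := @free_flat A _ _ _ f g fg (tens_mapl B' s z).
  by rewrite -tens_mapl_mapr gz0 linear0.
exists (tens_mapl B (freeF_eps A) y); rewrite -tens_mapl_mapr -yE.
rewrite (tens_mapl_comp (h := @modT_id k (op C) A)) //.
by rewrite tens_mapl_id.
Qed.
End TensorBasics.

Lemma tens_swapK (k : comPzRingType) (C : category) (A : modF k (op C)) (B : modF k C) z :
  @tens_swap k (op C) B A (tens_swap A B z) = z.
Proof.
apply: (@tensor_ext k C A B _ ((@tens_swap k (op C) B A : {linear _ -> tensor A B}) \o tens_swap A B) idfun) => x a b /=.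
by rewrite tens_liftE; apply: tens_liftE.
Qed.

(** Exchanging the factors replaces the category by its opposite and reduces this to
    [projective_flat]. *)
Lemma projective_flat_r (k : comPzRingType) (C : category) (B : modF k C)
    (A A' A'' : modF k (op C)) (f : modT A A') (g : modT A' A'') :
  projective B -> (forall x, exact_at (f x) (g x)) ->
  exact_at (tens_mapl B f) (tens_mapl B g).
Proof.
move=> pB fg z gz0.
have sw M N (h : modT M N) y :
    tens_swap N B (tens_mapl B h y) = @tens_mapr k (op C) B M N h (tens_swap M B y).
  apply: (@tensor_ext _ _ _ _ _ (tens_swap N B \o tens_mapl B h)
    (@tens_mapr k (op C) B M N h \o tens_swap M B)) => x a b /=.
  by rewrite tens_maplE !tens_liftE.
have sw' M N (h : modT M N) y :
    @tens_swap k (op C) B N (@tens_mapr k (op C) B M N h y) =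
    tens_mapl B h (@tens_swap k (op C) B M y).
  apply: (@tensor_ext k (op C) B M (tensor N B) ((@tens_swap k (op C) B N : {linear _ -> tensor N B}) \o @tens_mapr k (op C) B M N h)
    (tens_mapl B h \o (@tens_swap k (op C) B M : {linear _ -> tensor M B}))) => x a b /=.
  rewrite tens_maprE tens_liftE; symmetry; rewrite tens_liftE; exact: tens_maplE.
have [|y yE] := @projective_flat k (op C) B pB _ _ _ f g fg (tens_swap A' B z).
  by rewrite -sw gz0 linear0.
exists (@tens_swap k (op C) B A y : tensor A B).
by rewrite -sw' -yE tens_swapK.
Qed.

(** * Comparison of complexes of functors *)

Section Comparison.
Variables (k : pzRingType) (C : category).

Variables (P Y : nat -> modF k C) (dP : forall n, modT (P n.+1) (P n))
  (dY : forall n, modT (Y n.+1) (Y n)) (B : modF k C) (eY : modT (Y 0) B).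
Hypothesis projP : forall n, projective (P n).
Hypothesis dPP : forall n x p, dP n x (dP n.+1 x p) = 0.
Hypothesis exY0 : forall x, exact_at (dY 0 x) (eY x).
Hypothesis exY : forall n x, exact_at (dY n.+1 x) (dY n x).

Lemma lift_exists (A : modF k C) (eP : modT (P 0) A) (f : modT A B) :
  (forall x p, eP x (dP 0 x p) = 0) ->
  (forall x b, exists y, eY x y = b) ->
  exists u : forall n, modT (P n) (Y n),
    (forall n x p, u n x (dP n x p) = dY n x (u n.+1 x p)) /\
    (forall x p, eY x (u 0 x p) = f x (eP x p)).
Proof.
move=> ePd eYs.
pose inv n (u : modT (P n) (Y n)) := forall x q, exists y, u x (dP n x q) = dY n x y.
have [|u0 u0E] := projective_lift (d := eY) (f := modT_comp f eP) (@projP 0%N).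
  by move=> x p; have [y yE] := eYs x (f x (eP x p)); exists y.
have inv0 : inv 0 u0 by move=> x q; apply: exY0; rewrite u0E /= ePd linear0.
have step n (u : modT (P n) (Y n)) : inv n u ->
    exists u' : modT (P n.+1) (Y n.+1), forall x p, dY n x (u' x p) = u x (dP n x p).
  by move=> iu; apply: (projective_lift (f := modT_comp u (dP n))).
have inv_step n (u : modT (P n) (Y n)) (u' : modT (P n.+1) (Y n.+1)) :
    (forall x p, dY n x (u' x p) = u x (dP n x p)) -> inv n.+1 u'.
  by move=> uu' x q; apply: exY; rewrite uu' dPP linear0.
pose U := fix U n : {u : modT (P n) (Y n) | inv n u} :=
  match n with
  | 0 => exist _ u0 inv0
  | m.+1 => let s := cid (step m (projT1 (U m)) (projT2 (U m))) in
            exist _ (projT1 s) (inv_step m _ _ (projT2 s))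
  end.
exists (fun n => projT1 (U n)); split=> [n x p|x p]; last exact: u0E.
by rewrite /=; case: cid => u' /= ->.
Qed.

(** A chain map covering zero is null-homotopic. Only the two components of the homotopy that enter
    the identity in degree n + 1 are recorded. *)
Lemma null_homotopy (g : forall n, modT (P n) (Y n)) :
  (forall n x p, g n x (dP n x p) = dY n x (g n.+1 x p)) ->
  (forall x p, eY x (g 0 x p) = 0) ->
  forall n, exists (h : modT (P n) (Y n.+1)) (h' : modT (P n.+1) (Y n.+2)),
    forall x p, g n.+1 x p = dY n.+1 x (h' x p) + h x (dP n x p).
Proof.
move=> gd g0.
(* That is, g - h d takes values in cycles, so that exactness of Y provides the next component. *)
pose inv n (h : modT (P n) (Y n.+1)) :=
  forall x q, dY n x (h x (dP n x q)) = dY n x (g n.+1 x q).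
have step n (h : modT (P n) (Y n.+1)) : inv n h ->
    exists h' : modT (P n.+1) (Y n.+2),
      forall x p, g n.+1 x p = dY n.+1 x (h' x p) + h x (dP n x p).
  move=> ih; have [|h' h'E] := projective_lift (d := dY n.+1)
      (f := modT_sub (g n.+1) (modT_comp h (dP n))) (@projP n.+1).
    by move=> x p; apply: exY; rewrite /= linearB /= ih subrr.
  by exists h' => x p; rewrite h'E /= subrK.
suff hn n : exists h, inv n h by move=> n; have [h /step[h' hE]] := hn n; exists h, h'.
elim: n => [|n [h ih]].
  have [|h hE] := projective_lift (d := dY 0) (f := g 0) (@projP 0%N).
    by move=> x p; apply/exY0/g0.
  by exists h => x q; rewrite hE gd.
have [h' hE] := step n h ih; exists h' => x q.
have := hE x (dP n.+1 x q); rewrite dPP linear0 addr0 => <-.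
by rewrite gd.
Qed.
End Comparison.

Section MapF.
Variables (k : pzRingType) (c : nat).

(* A natural transformation X -> mapF c Y is a family of maps X n -> Y n depending on
   s : c -> n, natural in (n, s). *)
Definition map_mod (Y : modF k Sc_gr) (n : Sc_gr) : lmodType k := (grhom c n -> Y n : Type).

Definition map_map (Y : modF k Sc_gr) (m n : Sc_gr) (f : @hom Sc_gr m n)
    (u : map_mod Y m) : map_mod Y n :=
  fun s => mmap Y f (u (grcomp (sc_ret f) s)).

Fact map_map_linear Y m n f : linear (@map_map Y m n f).
Proof. by move=> r u v; apply: funext => s; rewrite /map_map linearP. Qed.
HB.instance Definition _ Y m n f :=
  GRing.isLinear.Build k _ _ _ (@map_map Y m n f) (@map_map_linear Y m n f).

Definition mapF (Y : modF k Sc_gr) : modF k Sc_gr.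
Proof.
refine (@ModF k Sc_gr (map_mod Y) (fun m n f => @map_map Y m n f) _ _).
- by move=> n u; apply: funext => s; rewrite /= /map_map mmap1 grcomp1m.
- move=> l m n f g u; apply: funext => s; rewrite /= /map_map mmapM /=.
  by rewrite grcompA.
Defined.

Section MapT.
Variables (Y Z : modF k Sc_gr) (h : modT Y Z).
Definition mapT_fun n (u : mapF Y n) : mapF Z n := fun s => h n (u s).
Fact mapT_linear n : linear (@mapT_fun n).
Proof. by move=> r u v; apply: funext => s; rewrite /mapT_fun linearP. Qed.
HB.instance Definition _ n :=
  GRing.isLinear.Build k _ _ _ (@mapT_fun n) (@mapT_linear n).
Fact mapT_nat m n (f : @hom Sc_gr m n) u :
  mapT_fun (mmap (mapF Y) f u) = mmap (mapF Z) f (mapT_fun u).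
Proof. by apply: funext => s; apply: mtr_nat. Qed.
Definition mapT : modT (mapF Y) (mapF Z) :=
  @ModT k Sc_gr (mapF Y) (mapF Z) (fun n => @mapT_fun n) mapT_nat.
End MapT.

(** At n, [mapF c] is a product indexed by the maps c -> n, and products of modules are exact. *)
Lemma mapT_exact (X Y Z : modF k Sc_gr) (f : modT X Y) (g : modT Y Z) n :
  exact_at (f n) (g n) -> exact_at (mapT f n) (mapT g n).
Proof.
move=> fg u u0.
have ex s : exists x, u s = f n x.
  by apply: fg; have := congr1 (fun v : mapF Z n => v s) u0.
exists (fun s => projT1 (cid (ex s))); apply: funext => s.
by rewrite /= /mapT_fun; case: cid.
Qed.

Lemma mapT_surj (X Y : modF k Sc_gr) (f : modT X Y) n :
  (forall y, exists x, f n x = y) -> forall y, exists x, mapT f n x = y.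
Proof.
move=> fs u; exists (fun s => projT1 (cid (fs (u s)))); apply: funext => s.
by rewrite /= /mapT_fun; case: cid.
Qed.
End MapF.
Arguments mapF {k} c Y.
Arguments mapT {k} c {Y Z} h.

Section PullT.
Variables (k : pzRingType) (C D : category) (phi : functor C D) (M N : modF k D) (f : modT M N).
Fact pullT_nat x y (h : @hom C x y) a :
  f (phi y) (mmap (pull phi M) h a) = mmap (pull phi N) h (f (phi x) a).
Proof. exact: mtr_nat. Qed.
Definition pullT : modT (pull phi M) (pull phi N) :=
  @ModT k C (pull phi M) (pull phi N) (fun x => f (phi x)) pullT_nat.
End PullT.

Section GoodT.
Variables (k : pzRingType) (N c : nat).

Lemma retsum_lin (V : lmodType k) a n (s : grhom a n) r
    (Phi Phi' : schom n (copies N n a) -> V) :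
  retsum s (fun t => r *: Phi t + Phi' t) = r *: retsum s Phi + retsum s Phi'.
Proof.
elim: N Phi Phi' => [|N' IH] Phi Phi' /=; first by rewrite scaler0 addr0.
by rewrite IH altsum_lin scalerBr opprD addrACA.
Qed.

Variable W : modF k Sc_gr.
Local Notation W' := (pull (copiesF N c) W).

Definition retsum_fun n (w : W n) : mapF c W' n :=
  fun s => retsum s (fun t => mmap W (t : @hom Sc_gr n (copies N n c)) w).

Fact retsum_fun_linear n : linear (@retsum_fun n).
Proof.
move=> r w w'; apply: funext => s; apply: etrans (retsum_lin _ _ _ _); rewrite /retsum_fun.
by congr retsum; apply: funext => t; rewrite linearP.
Qed.
HB.instance Definition _ n :=
  GRing.isLinear.Build k _ _ _ (@retsum_fun n) (@retsum_fun_linear n).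

Fact retsum_fun_nat m n (f : @hom Sc_gr m n) w :
  retsum_fun (mmap W f w) = mmap (mapF c W') f (retsum_fun w).
Proof.
apply: funext => s; rewrite /retsum_fun /= /map_map /=.
rewrite (raddf_retsum (mmap W (copies_map N c f : @hom Sc_gr (copies N m c) (copies N n c)))).
transitivity (retsum s (fun t => mmap W (sccomp t f : @hom Sc_gr m (copies N n c)) w)).
  congr retsum; apply: funext => t.
  exact: esym (@mmapM k Sc_gr W m n (copies N n c) t f w).
apply: etrans (retsum_nat f s (fun t => mmap W (t : @hom Sc_gr m (copies N n c)) w)) _.
congr retsum; apply: funext => t.
exact: (@mmapM k Sc_gr W m (copies N m c) (copies N n c) (copies_map N c f) t w).
Qed.
Definition retsumT : modT W (mapF c W') :=
  @ModT k Sc_gr W (mapF c W') (fun n => @retsum_fun n) retsum_fun_nat.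

Local Notation W0 := (pull (copiesF 0 c) W).

(** [copiesF 0 c] is constant at c, so [u] assigns an element of W c to each map c -> n. This
    carries the contribution of the map trivial on all copies, which factors through c. *)
Definition rho_fun n (u : mapF c W0 n) : mapF c W' n :=
  fun s => mmap W (rho N n c : @hom Sc_gr c (copies N n c)) (u s).
Fact rho_fun_linear n : linear (@rho_fun n).
Proof. by move=> r u v; apply: funext => s; rewrite /rho_fun linearP. Qed.
HB.instance Definition _ n :=
  GRing.isLinear.Build k _ _ _ (@rho_fun n) (@rho_fun_linear n).
Fact rho_fun_nat m n (f : @hom Sc_gr m n) u :
  rho_fun (mmap (mapF c W0) f u) = mmap (mapF c W') f (rho_fun u).
Proof.
apply: funext => s; set x := u (grcomp (sc_ret f) s).
have E : sccomp (rho N n c) (scid c) = sccomp (copies_map N c f) (rho N m c).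
  by rewrite sccompm1 rho_nat.
apply: etrans (esym (@mmapM k Sc_gr W c c (copies N n c) (rho N n c) (scid c) x)) _.
apply: etrans (@mmapM k Sc_gr W c (copies N m c) (copies N n c) (copies_map N c f) (rho N m c) x).
exact: (congr1 (fun g => mmap W (g : @hom Sc_gr c (copies N n c)) x) E).
Qed.
Definition rhoT : modT (mapF c W0) (mapF c W') :=
  @ModT k Sc_gr (mapF c W0) (mapF c W') (fun n => @rho_fun n) rho_fun_nat.
End GoodT.

(** * Tensoring with the pullback of a free functor *)

Section FreeGlue.
Variables (k : comPzRingType) (A : modF k gr).
Local Notation M := (@freeF k gr A).
Local Notation R := (pull (opF beta) M).

Definition mgen c n (s : grhom c n) (a : A c) : M n :=
  pres_gen (fun=> False) (existT _ c (s, a) : @fgen k gr A n).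

Lemma mmap_mgen c n p (h : grhom n p) (s : grhom c n) (a : A c) :
  mmap M (h : @hom gr n p) (mgen s a) = mgen (grcomp h s) a.
Proof. exact: pres_lift_gen. Qed.

Definition pull_free_iso (n : Sc_gr) :
    {linear R n -> @presented k (@fgen k gr A n) (fun=> False)} := idfun.

Definition pull_free_map (m n : Sc_gr) (f : @hom Sc_gr m n) (g : @fgen k gr A n) :
    @fgen k gr A m :=
  existT _ (tag g) (grcomp (sc_ret f) (tagged g).1, (tagged g).2).

Lemma pull_free_ind (B : modF k Sc_gr) (Q : tensor R B -> Prop) :
  Q 0 -> (forall p q, Q p -> Q q -> Q (p + q)) ->
  (forall c n (s : grhom c n) (a : A c) (b : B n), Q (@tens k Sc_gr R B n (mgen s a) b)) ->
  forall z, Q z.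
Proof.
move=> Q0 QD Qt; apply: (@tens_glue_ind k Sc_gr R (fun n => @fgen k gr A n) B pull_free_iso Q) => //.
- by move=> n g; exists (pres_gen (fun=> False) g).
- by move=> n u [c [s a]] b E; rewrite (E : u = mgen s a).
Qed.

Section Glue.
Variables (B : modF k Sc_gr) (V : lmodType k).
Variable phi : forall c, A c -> forall n, grhom c n -> {linear B n -> V}.
Hypothesis phi_nat : forall m n (f : @hom Sc_gr m n) c (a : A c) (s : grhom c n) w,
  phi a (grcomp (sc_ret f) s) w = phi a s (mmap B f w).

Definition pull_free_phi (n : Sc_gr) (g : @fgen k gr A n) : {linear B n -> V} :=
  phi (tagged g).2 (tagged g).1.

Lemma pull_free_phi_nat (m n : Sc_gr) (f : @hom Sc_gr m n) (g : @fgen k gr A n) b :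
  pull_free_phi (pull_free_map f g) b = pull_free_phi g (mmap B f b).
Proof. exact: phi_nat. Qed.

Definition pull_free_glue : {linear tensor R B -> V} :=
  @tens_glue k Sc_gr R (fun n => @fgen k gr A n) B V pull_free_map pull_free_iso
    (fun m n f a => erefl) pull_free_phi pull_free_phi_nat.

Lemma pull_free_glueE c n (s : grhom c n) (a : A c) (b : B n) :
  pull_free_glue (@tens k Sc_gr R B n (mgen s a) b) = phi a s b.
Proof.
exact: (@tens_glueE k Sc_gr R (fun n => @fgen k gr A n) B V pull_free_map
  pull_free_iso _ pull_free_phi pull_free_phi_nat n (mgen s a) (existT _ c (s, a))).
Qed.
End Glue.

Lemma sc_retK m n (f : schom m n) : grcomp (sc_ret f) (sc_sec f) = gid m.
Proof. by have [t [w [phi []]]] := is_splitE (sc_split f). Qed.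

Section Push.
Variables (N : nat) (B X : modF k Sc_gr).
Variable eta : forall c, modT B (mapF c (pull (copiesF N c) X)).

(** The generator placed in the first factor is the inclusion of c into the copies: every t in the
    sums restricts to [s] on c, and so sends this generator to [mgen s a]. *)
Definition push_phi c (a : A c) n (s : grhom c n) (w : B n) : tensor R X :=
  @tens k Sc_gr R X (copies N n c) (mgen (sc_sec (rho N n c)) a) (eta c n w s).
Fact push_phi_linear c a n s : linear (@push_phi c a n s).
Proof.
have [hDl hDr hZl hZr hF] := tens_balanced R X.
by move=> r w w'; rewrite /push_phi linearP -hZr -hDr.
Qed.
HB.instance Definition _ c a n s :=
  GRing.isLinear.Build k _ _ _ (@push_phi c a n s) (@push_phi_linear c a n s).

Lemma push_phi_nat m n (f : @hom Sc_gr m n) c (a : A c) (s : grhom c n) w :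
  push_phi a (grcomp (sc_ret f) s) w = push_phi a s (mmap B f w).
Proof.
have [hDl hDr hZl hZr hF] := tens_balanced R X.
rewrite /push_phi mtr_nat.
apply: etrans (hF _ _ (copies_map N c f : @hom Sc_gr (copies N m c) (copies N n c)) _ _).
congr tens; apply: etrans _ (esym (mmap_mgen _ _ _)); congr mgen.
(* The inclusion of c into the copies of n goes through the section of [copies_map N c f], which its
   retraction cancels. *)
by rewrite -(rho_nat N c f) /= grcompA sc_retK grcomp1m.
Qed.

Definition push : {linear tensor R B -> tensor R X} :=
  pull_free_glue (phi := fun c a n s => @push_phi c a n s) push_phi_nat.

Lemma pushE c n (s : grhom c n) (a : A c) (b : B n) :
  push (@tens k Sc_gr R B n (mgen s a) b) =
  @tens k Sc_gr R X (copies N n c) (mgen (sc_sec (rho N n c)) a) (eta c n b s).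
Proof. exact: pull_free_glueE. Qed.
End Push.

(** The balancing relation moves each t to the first factor, where it yields [mgen s a]. All terms
    are then the same tensor, and their signs add up to -1. *)
Lemma push_retsum N B z : push (fun c => retsumT N.+1 c B) z = - z.
Proof.
elim/pull_free_ind: z => [|p q|c n s a b]; first by rewrite linear0 oppr0.
  by rewrite linearD opprD => -> ->.
have [hDl hDr hZl hZr hF] := tens_balanced R B.
rewrite pushE; set e := mgen _ _.
have lin : linear (fun b : B (copies N.+1 n c) => @tens k Sc_gr R B (copies N.+1 n c) e b).
  by move=> r w w'; rewrite -hZr -hDr.
pose L : {linear B (copies N.+1 n c) -> tensor R B} :=
  HB.pack (fun b : B (copies N.+1 n c) => @tens k Sc_gr R B (copies N.+1 n c) e b) (GRing.isLinear.Build k _ _ _ _ lin).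
apply: etrans (raddf_retsum L s _) _.
apply: etrans _ (@retsum_cst _ N c n s _).
apply: etrans _ (@retsum_sec _ N.+1 c n s (fun h => @tens k Sc_gr R B n (mgen h a) b)).
congr retsum; apply: funext => t; rewrite -mmap_mgen.
exact: esym (hF _ _ (t : @hom Sc_gr n (copies N.+1 n c)) e b).
Qed.

Local Notation A' := (pull (opF beta) A).
Local Notation L := (@freeF k (op Sc_gr) A').

(** The generator of L given by an element of A c goes to the one carried by the identity of c. L is
    free over the opposite of S_c(gr), so tensoring with it is exact. *)
Definition unit_map : modT L R :=
  @freeF_lift k (op Sc_gr) A' R (fun c a => @mgen c c (gid c) a).

Lemma unit_mapE B c a b :
  tens_mapl B unit_map (@free_tens k Sc_gr A' B (existT _ c a) b) =
  @tens k Sc_gr R B c (mgen (gid c) a) b.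
Proof.
rewrite tens_maplE; congr tens; rewrite freeF_liftE /=.
by apply: etrans (mmap_mgen _ _ _) _; rewrite grcompm1.
Qed.

Section Sig.
Variables (B X : modF k Sc_gr).
Variable sigma : forall c, modT B (mapF c (pull (copiesF 0 c) X)).

Definition sigma_push_phi c (a : A c) n (s : grhom c n) (w : B n) : tensor L X :=
  @free_tens k Sc_gr A' X (existT _ c a) (sigma c n w s).
Fact sigma_push_phi_linear c a n s : linear (@sigma_push_phi c a n s).
Proof.
have [hDl hDr hZl hZr hF] := tens_balanced L X.
by move=> r w w'; rewrite /sigma_push_phi linearP -hZr -hDr.
Qed.
HB.instance Definition _ c a n s :=
  GRing.isLinear.Build k _ _ _ (@sigma_push_phi c a n s) (@sigma_push_phi_linear c a n s).

Lemma sigma_push_phi_nat m n (f : @hom Sc_gr m n) c (a : A c) (s : grhom c n) w :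
  sigma_push_phi a (grcomp (sc_ret f) s) w = sigma_push_phi a s (mmap B f w).
Proof.
rewrite /sigma_push_phi mtr_nat; congr free_tens.
exact: esym (@mmap1 k Sc_gr X c _).
Qed.

Definition sigma_push : {linear tensor R B -> tensor L X} :=
  pull_free_glue (phi := fun c a n s => @sigma_push_phi c a n s) sigma_push_phi_nat.

Lemma sigma_pushE c n (s : grhom c n) (a : A c) (b : B n) :
  sigma_push (@tens k Sc_gr R B n (mgen s a) b) =
  @free_tens k Sc_gr A' X (existT _ c a) (sigma c n b s).
Proof. exact: pull_free_glueE. Qed.

(** [rho] moves across the tensor sign, where its retraction cancels its section and leaves the
    identity of c. This part of the map therefore factors through L. *)
Lemma push_rho N z :
  push (fun c => modT_comp (rhoT N c X) (sigma c)) z = tens_mapl X unit_map (sigma_push z).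
Proof.
elim/pull_free_ind: z => [|p q|c n s a b]; first by rewrite !linear0.
  by rewrite !linearD => -> ->.
rewrite pushE sigma_pushE unit_mapE /= /rho_fun.
have [hDl hDr hZl hZr hF] := tens_balanced R X.
apply: etrans (esym (hF _ _ (rho N n c : @hom Sc_gr c (copies N n c)) _ _)) _; congr tens.
by apply: etrans (mmap_mgen _ _ _) _; rewrite sc_retK.
Qed.
End Sig.
End FreeGlue.

Section PushLemmas.
Variables (k : comPzRingType) (A : modF k gr).
Local Notation R := (pull (opF beta) (@freeF k gr A)).
Local Notation L := (@freeF k (op Sc_gr) (pull (opF beta) A)).

Lemma push_add N (B X : modF k Sc_gr)
    (eta eta1 eta2 : forall c, modT B (mapF c (pull (copiesF N c) X))) z :
  (forall c n b, eta c n b = eta1 c n b + eta2 c n b) ->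
  push A eta z = push A eta1 z + push A eta2 z.
Proof.
move=> E; elim/pull_free_ind: z => [|p q|c n s a b]; first by rewrite !linear0 addr0.
  by rewrite !linearD => -> ->; rewrite addrACA.
rewrite !pushE E; exact: (balDr (tens_balanced R X)).
Qed.

Lemma push_eq0 N (B X : modF k Sc_gr)
    (eta : forall c, modT B (mapF c (pull (copiesF N c) X))) z :
  (forall c n b, eta c n b = 0) -> push A eta z = 0.
Proof.
move=> E; have := push_add (eta := eta) (eta1 := eta) (eta2 := eta) z.
rewrite -{1}[push A eta z]addr0 => /(_ _)/addrI<- // c n b.
by rewrite E addr0.
Qed.

Lemma push_post N (B X Y : modF k Sc_gr) (d : modT X Y)
    (eta : forall c, modT B (mapF c (pull (copiesF N c) X)))
    (eta' : forall c, modT B (mapF c (pull (copiesF N c) Y))) z :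
  (forall c n b, eta' c n b = mapT c (pullT (copiesF N c) d) n (eta c n b)) ->
  push A eta' z = tens_mapr R d (push A eta z).
Proof.
move=> E; elim/pull_free_ind: z => [|p q|c n s a b]; first by rewrite !linear0.
  by rewrite !linearD => -> ->.
by rewrite !pushE E tens_maprE.
Qed.

Lemma push_pre N (B B' X : modF k Sc_gr) (d : modT B B')
    (eta : forall c, modT B' (mapF c (pull (copiesF N c) X)))
    (eta' : forall c, modT B (mapF c (pull (copiesF N c) X))) z :
  (forall c n b, eta' c n b = eta c n (d n b)) ->
  push A eta' z = push A eta (tens_mapr R d z).
Proof.
move=> E; elim/pull_free_ind: z => [|p q|c n s a b]; first by rewrite !linear0.
  by rewrite !linearD => -> ->.
by rewrite tens_maprE !pushE E.
Qed.

Lemma sigma_push_nat (B B' X X' : modF k Sc_gr) (d : modT B B') (d' : modT X X')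
    (sigma : forall c, modT B (mapF c (pull (copiesF 0 c) X)))
    (sigma' : forall c, modT B' (mapF c (pull (copiesF 0 c) X'))) z :
  (forall c n b, sigma' c n (d n b) = mapT c (pullT (copiesF 0 c) d') n (sigma c n b)) ->
  sigma_push A sigma' (tens_mapr R d z) = tens_mapr L d' (sigma_push A sigma z).
Proof.
move=> E; elim/pull_free_ind: z => [|p q|c n s a b]; first by rewrite !linear0.
  by rewrite !linearD => -> ->.
by rewrite tens_maprE !sigma_pushE E /free_tens tens_maprE.
Qed.

End PushLemmas.

Lemma retsumT_nat (k : pzRingType) N c (X Y : modF k Sc_gr) (h : modT X Y) n b :
  retsumT N c Y n (h n b) = mapT c (pullT (copiesF N c) h) n (retsumT N c X n b).
Proof.
apply: funext => s; apply: etrans _ (esym (raddf_retsum (h (copies N n c)) s _)).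
congr retsum; apply: funext => t.
exact: esym (mtr_nat h (t : @hom Sc_gr n (copies N n c)) b).
Qed.

Lemma rhoT_nat (k : pzRingType) N c (X Y : modF k Sc_gr) (h : modT X Y) n u :
  rhoT N c Y n (mapT c (pullT (copiesF 0 c) h) n u) =
  mapT c (pullT (copiesF N c) h) n (rhoT N c X n u).
Proof.
apply: funext => s.
exact: esym (mtr_nat h (rho N n c : @hom Sc_gr c (copies N n c)) (u s)).
Qed.

(** * Acyclicity of the pullbacks of projective functors *)

Section Acyclic.
Variables (k : comPzRingType) (F : modF k (op gr)) (N : nat).
Hypothesis smallF : forall n (x : F n), small_elt N.+1 x.
Local Notation B := (pull beta F).

Definition ev_fun c n (x : B n) : mapF c (pull (copiesF 0 c) B) n :=
  fun s => mmap F (s : @hom (op gr) n c) x.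
Fact ev_fun_linear c n : linear (@ev_fun c n).
Proof. by move=> r x y; apply: funext => s; rewrite /ev_fun linearP. Qed.
HB.instance Definition _ c n :=
  GRing.isLinear.Build k _ _ _ (@ev_fun c n) (@ev_fun_linear c n).
Fact ev_fun_nat c m n (f : @hom Sc_gr m n) x :
  ev_fun (mmap B f x) = mmap (mapF c (pull (copiesF 0 c) B)) f (@ev_fun c m x).
Proof.
apply: funext => s.
apply: etrans (esym (@mmap1 k Sc_gr B c _)).
exact: mmap_comp_op.
Qed.
Definition evT c : modT B (mapF c (pull (copiesF 0 c) B)) :=
  @ModT k Sc_gr B (mapF c (pull (copiesF 0 c) B)) (@ev_fun c) (@ev_fun_nat c).

(** The vanishing of the alternating sum on F, split by [altsum_retsum]. *)
Lemma retsum_rho_ev c n (x : B n) :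
  retsumT N.+1 c B n x + rhoT N.+1 c B n (evT c n x) = 0.
Proof.
apply: funext => s.
have := @smallF n x N.+1 n c (gid n) s (leqnn _).
rewrite altsum_retsum => E; apply: etrans _ E; congr (_ + _).
exact: mmap_comp_op.
Qed.

Variable W : resolution B.

(** Injectivity is what has to be proved in degree 0: surjectivity of [tens_pull] holds for every M,
    since [beta] is the identity on objects. *)
Definition acyclic (M : modF k gr) :=
  (forall j, exact_at (tens_mapr (pull (opF beta) M) (res_d W j.+1))
                      (tens_mapr (pull (opF beta) M) (res_d W j))) /\
  injective (tens_pull beta (M : modF k (op (op gr))) F).

Lemma acyclic_free (A : modF k gr) : acyclic (@freeF k gr A).
Proof.
set R := pull (opF beta) (@freeF k gr A).
pose L := @freeF k (op Sc_gr) (pull (opF beta) A).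
split=> [j|].
  (* [evT c] lifts to the resolution W, because [mapF c] preserves exactness. *)
  have sgP c : exists u : forall n, modT (W n) (mapF c (pull (copiesF 0 c) (W n))),
      (forall n x p, u n x (res_d W n x p) =
         mapT c (pullT (copiesF 0 c) (res_d W n)) x (u n.+1 x p)) /\
      (forall x p, mapT c (pullT (copiesF 0 c) (res_e W)) x (u 0%N x p) = evT c x (res_e W x p)).
    apply: (@lift_exists k Sc_gr W (fun n => mapF c (pull (copiesF 0 c) (W n)))
             (res_d W) (fun n => mapT c (pullT (copiesF 0 c) (res_d W n)))
             _ (mapT c (pullT (copiesF 0 c) (res_e W)))).
    - exact: res_proj.
    - by move=> n x p; apply: res_dd.
    - by move=> x; apply: mapT_exact => w w0; exact: (proj1 (@res_exact0 k Sc_gr B W _ w) w0).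
    - by move=> n x; apply: mapT_exact => w w0; exact: (proj1 (@res_exact k Sc_gr B W _ _ w) w0).
    - by move=> x p; apply/res_exact0; exists p.
    - by move=> x; apply: mapT_surj => b; apply: res_surj.
  pose sg c := projT1 (cid (sgP c)).
  have sgd c n x p : sg c n x (res_d W n x p) =
         mapT c (pullT (copiesF 0 c) (res_d W n)) x (sg c n.+1 x p).
    by rewrite /sg; case: cid => u [].
  have sge c x p : mapT c (pullT (copiesF 0 c) (res_e W)) x (sg c 0%N x p) = evT c x (res_e W x p).
    by rewrite /sg; case: cid => u [].
  (* A chain map covering the sum of [retsum_rho_ev], which is zero; hence it is null-homotopic. *)
  pose g c n := modT_add (retsumT N.+1 c (W n)) (modT_comp (rhoT N.+1 c (W n)) (sg c n)).
  have hP c : exists (h : modT (W j) (mapF c (pull (copiesF N.+1 c) (W j.+1))))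
      (h' : modT (W j.+1) (mapF c (pull (copiesF N.+1 c) (W j.+2)))), forall x p,
      g c j.+1 x p = mapT c (pullT (copiesF N.+1 c) (res_d W j.+1)) x (h' x p) +
                     h x (res_d W j x p).
    apply: (@null_homotopy k Sc_gr W (fun n => mapF c (pull (copiesF N.+1 c) (W n)))
             (res_d W) (fun n => mapT c (pullT (copiesF N.+1 c) (res_d W n)))
             _ (mapT c (pullT (copiesF N.+1 c) (res_e W)))).
    - exact: res_proj.
    - by move=> n x p; apply: res_dd.
    - by move=> x; apply: mapT_exact => w w0; exact: (proj1 (@res_exact0 k Sc_gr B W _ w) w0).
    - by move=> n x; apply: mapT_exact => w w0; exact: (proj1 (@res_exact k Sc_gr B W _ _ w) w0).
    - by move=> n x p; rewrite [g c n x _]/= [g c n.+1 x _]/= linearD -retsumT_nat sgd rhoT_nat.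
    - move=> x p; rewrite [g c 0%N x _]/= linearD -retsumT_nat -rhoT_nat sge.
      exact: retsum_rho_ev.
  pose h c := projT1 (cid (hP c)).
  have h'P c : exists h' : modT (W j.+1) (mapF c (pull (copiesF N.+1 c) (W j.+2))),
      forall x p, g c j.+1 x p =
        mapT c (pullT (copiesF N.+1 c) (res_d W j.+1)) x (h' x p) + h c x (res_d W j x p).
    exact: projT2 (cid (hP c)).
  pose h' c := projT1 (cid (h'P c)).
  have hE c x p : g c j.+1 x p = mapT c (pullT (copiesF N.+1 c) (res_d W j.+1)) x (h' c x p) +
                     h c x (res_d W j x p) by rewrite /h'; case: cid.
  move=> z dz.
  (* The image of the cycle z in L (x) W is a cycle, hence a boundary as L is flat. *)
  have [y yE] : exists y, sigma_push A (fun c => sg c j.+1) z = tens_mapr L (res_d W j.+1) y.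
    apply: (@projective_flat k Sc_gr L (@freeF_projective k (op Sc_gr) _) _ _ _ _ (res_d W j)).
      by move=> x w w0; exact: (proj1 (@res_exact k Sc_gr B W _ _ w) w0).
    rewrite -(sigma_push_nat (d := res_d W j) (sigma' := fun c => sg c j)).
      by rewrite dz linear0.
    by move=> c n b; apply: sgd.
  have E1 : push A (fun c => g c j.+1) z =
      - z + tens_mapl (W j.+1) (unit_map A) (sigma_push A (fun c => sg c j.+1) z).
    rewrite (@push_add k A N.+1 _ _ _ (fun c => retsumT N.+1 c (W j.+1))
      (fun c => modT_comp (rhoT N.+1 c (W j.+1)) (sg c j.+1))) //.
    by rewrite push_retsum push_rho.
  (* The other term of the homotopy involves the differential of z, which is zero. *)
  have E2 : push A (fun c => g c j.+1) z =
      tens_mapr R (res_d W j.+1) (push A h' z).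
    rewrite (@push_add k A N.+1 _ _ _
      (fun c => modT_comp (mapT c (pullT (copiesF N.+1 c) (res_d W j.+1))) (h' c))
      (fun c => modT_comp (h c) (res_d W j))) //.
    rewrite (@push_pre k A N.+1 _ _ _ (res_d W j) h (fun c => modT_comp (h c) (res_d W j))) // dz linear0 addr0.
    by apply: push_post.
  exists (tens_mapl (W j.+2) (unit_map A) y - push A h' z).
  by rewrite linearB /= -E2 E1 yE tens_mapl_mapr opprD opprK addrCA subrr addr0.
(* In degree 0 a left inverse of the comparison is built: it sends the summand F c at (c, a) to
   tensors with the identity of c. *)
suff [r rE] : exists r : {linear @tensor k (op gr) (@freeF k gr A) F -> tensor R B},
    forall z, r (tens_pull beta _ F z) = z.
  by move=> z z' E; rewrite -[z]rE E rE.
pose lam (i : {c : op gr & A c}) (x : F (tag i)) : tensor R B :=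
  @tens k Sc_gr R B (tag i) (mgen (gid (tag i)) (tagged i)) x.
have lam_lin i : linear (lam i).
  have [hDl hDr hZl hZr hF] := tens_balanced R B.
  by move=> r w w'; rewrite /lam -hZr -hDr.
pose Lam i : {linear F (tag i) -> tensor R B} :=
  HB.pack (lam i) (GRing.isLinear.Build k _ _ _ _ (lam_lin i)).
exists (@free_tens_lift k (op gr) A F _ Lam) => z.
(* The same identity for F itself, where the alternating sum vanishes exactly and no homotopy is
   involved. *)
have E : - z + tens_mapl B (unit_map A) (sigma_push A evT z) = 0.
  have := push_rho (A := A) evT N.+1 z; rewrite -(push_retsum N z) => <-.
  rewrite -(@push_add k A N.+1 _ _
    (fun c => modT_add (retsumT N.+1 c B) (modT_comp (rhoT N.+1 c B) (evT c)))) //.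
  by apply: push_eq0 => c n b; apply: retsum_rho_ev.
have {E} E : z = tens_mapl B (unit_map A) (sigma_push A evT z).
  by apply/esym/eqP; rewrite -subr_eq0 addrC E.
rewrite [RHS]E {E}; elim/pull_free_ind: z => [|p q|c n s a b].
- by rewrite !linear0.
- by rewrite !linearD => -> ->.
rewrite sigma_pushE unit_mapE.
have -> : tens_pull beta _ F (@tens k Sc_gr R B n (mgen s a) b) =
    @free_tens k (op gr) A F (existT _ c a) (mmap F (s : @hom (op gr) n c) b).
  apply: etrans (tens_liftE _ _ _) _.
  exact: (@free_tens_gen k (op gr) A F n (existT _ c (s, a)) b).
exact: (@free_tens_liftE k (op gr) A F _ Lam (existT _ c a)).
Qed.

(** M is a retract of [freeF M], and both properties pass to retracts. *)
Lemma acyclic_projective (M : modF k gr) : projective M -> acyclic M.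
Proof.
move=> pM; have [s sK] := pM _ _ (freeF_eps M)
  (@modT_id k gr M) (@freeF_eps_surj k gr M).
set e := freeF_eps M in sK.
have [ex inj] := acyclic_free M.
pose s' := pullT (opF beta) (s : @modT k (op (op gr)) _ _).
pose e' := pullT (opF beta) (e : @modT k (op (op gr)) _ _).
have sK' (X : modF k Sc_gr) z : tens_mapl X e' (tens_mapl X s' z) = z.
  rewrite (tens_mapl_comp (h := @modT_id k (op Sc_gr) (pull (opF beta) M))) //.
    by rewrite tens_mapl_id.
  by move=> n a; rewrite [RHS]sK.
split=> [j z z0|z z' E].
  have [|y yE] := ex j (tens_mapl (W j.+1) s' z).
    by rewrite -tens_mapl_mapr z0 linear0.
  exists (tens_mapl _ e' y).
  by rewrite -tens_mapl_mapr -yE sK'.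
have pull_nat y : tens_pull beta _ F (tens_mapl B s' y) =
    @tens_mapl k (op gr) _ _ F s (tens_pull beta M F y).
  apply: (@tensor_ext _ _ _ _ _ (tens_pull beta _ F \o tens_mapl B s')
    (@tens_mapl k (op gr) _ _ F s \o tens_pull beta M F)) => n a b.
  rewrite /= tens_maplE; apply: etrans (tens_liftE _ _ _) _.
  rewrite tens_liftE; exact: esym (tens_maplE _ _ _).
rewrite -[z]sK' -[z']sK' (inj (tens_mapl B s' z) (tens_mapl B s' z')) //.
by apply: etrans (pull_nat z) _; rewrite E -pull_nat.
Qed.
End Acyclic.

(** * Quasi-isomorphisms and double complexes *)

Section Qis.
Variable k : pzRingType.
Implicit Types X Y Z : chain_complex k.

Definition cyc X p : X p -> Prop :=
  match p return X p -> Prop with 0 => fun=> True | p'.+1 => fun x => cd X p' x = 0 end.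

(** An isomorphism in homology, phrased with cycles and boundaries to keep quotient modules out of
    the diagram chases. *)
Record qis X Y (f : chain_map X Y) : Prop := Qis {
  qis_inj : forall p x y, cyc x -> f p x = cd Y p y -> exists x', x = cd X p x';
  qis_surj : forall p (y : Y p), cyc y -> exists x y', cyc x /\ y = f p x + cd Y p y'
}.

Lemma iso_qis X Y (f : chain_map X Y) :
  (forall n, injective (f n)) -> (forall n y, exists x, f n x = y) -> qis f.
Proof.
move=> fi fs; split=> [p x y _|p y].
  by have [x' <-] := fs _ y; rewrite -cmap_cd => /fi ->; exists x'.
have [x <-] := fs _ y => cx; exists x, 0; rewrite linear0 addr0; split=> //.
case: p x {y} cx => //= p x; rewrite -cmap_cd -[RHS](linear0 (f p)).
exact: fi.
Qed.

Lemma qis_homology X Y (f : chain_map X Y) n : qis f -> bijective (homology_map f n).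
Proof.
move=> [fi fs].
have cycP V p (z : cycles V p) : cyc (val z).
  by case: z => z; case: p z => //= p z; rewrite unfold_in => /eqP.
have Pcyc (V : chain_complex k) p (z : V p) : cyc z -> z \in @is_cycle k V p.
  by case: p z => //= p z dz; rewrite unfold_in; apply/eqP.
have inj : injective (homology_map f n).
  move=> a b /eqP; rewrite -subr_eq0 -linearB => /eqP ab0; apply/eqP.
  rewrite -subr_eq0; apply/eqP; move: (a - b) ab0 => {a b} a.
  have [z <-] := quot_pi_surj a; rewrite homology_mapE.
  rewrite -[in RHS](linear0 (@quot_pi _ _ _ (is_boundary_submod Y n))).
  move=> /quot_piP; rewrite subr0 => /asboolP[y /fi[//|x xE]].
  rewrite -[RHS](linear0 (@quot_pi _ _ _ (is_boundary_submod X n))).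
  by apply/quot_piP; rewrite subr0; apply/asboolP; exists x.
have surj b : exists a, homology_map f n a = b.
  have [z <-] := quot_pi_surj b; have [x [y [cx zE]]] := fs n (val z) (cycP _ _ z).
  exists (quot_pi (is_boundary_submod X n) (SubMod (subS := is_cycle_submod X n) (Pcyc _ _ _ cx))).
  rewrite homology_mapE; apply/quot_piP/asboolP; exists (- y).
  by rewrite linearB /= zE opprD addrA subrr sub0r linearN.
exists (fun b => projT1 (cid (surj b))) => [a|b]; last by case: cid.
by apply: inj; case: cid.
Qed.

(* Only elements that survive from some stage on are lifted, so that finitely many
   of them lift to a common stage. *)
Lemma qis_union X Y (f : chain_map X Y) (Xn Yn : nat -> chain_complex k)
    (fn : forall N, chain_map (Xn N) (Yn N))
    (i : forall N, chain_map (Xn N) X) (j : forall N, chain_map (Yn N) Y) :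
  (forall N p x, f p (i N p x) = j N p (fn N p x)) ->
  (forall N p, injective (i N p)) -> (forall N p, injective (j N p)) ->
  (forall p x, exists N, forall N', (N <= N')%N -> exists x', i N' p x' = x) ->
  (forall p y, exists N, forall N', (N <= N')%N -> exists y', j N' p y' = y) ->
  (forall N, qis (fn N)) -> qis f.
Proof.
move=> E ii ji iS jS qn; split=> [p x y cx fx|p y cy].
  have [[N1 /(_ _ (leq_maxl N1 _)) h1] [N2 h2]] := (iS p x, jS p.+1 y).
  have [x' xE] := h1 N2; have [y' yE] := h2 _ (leq_maxr N1 N2).
  have [||x'' x''E] := @qis_inj _ _ _ (qn (maxn N1 N2)) p x' y'.
  - clear - cx xE ii; case: p x cx x' xE => //= p x dx x' xE.
    by apply: (ii _ p); rewrite linear0 cmap_cd xE.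
  - by apply: (ji _ p); rewrite -E xE cmap_cd yE.
  by exists (i _ _ x''); rewrite -cmap_cd -x''E.
have [N h] := jS p y; have [y' yE] := h N (leqnn N).
have [|x [y'' [cx y'E]]] := @qis_surj _ _ _ (qn N) p y'.
  clear - cy yE ji; case: p y cy y' yE => //= p y dy y' yE.
  by apply: (ji _ p); rewrite linear0 cmap_cd yE.
exists (i N p x), (j N _ y''); split; last by rewrite E -cmap_cd -linearD -y'E.
by clear - cx; case: p x cx => //= p x dx; rewrite -cmap_cd dx linear0.
Qed.
End Qis.

(** * Mapping cones *)

Section Cone.
Variables (k : pzRingType) (X Y : chain_complex k) (u : chain_map X Y).

Definition cone p : lmodType k :=
  match p with 0 => Y 0 | p'.+1 => (X p' * Y p'.+1)%type : lmodType k end.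

Definition cone_d0 (x : X 0 * Y 1) : Y 0 := u 0%N x.1 + cd Y 0 x.2.
Fact cone_d0_linear : linear cone_d0.
Proof.
by move=> r x y; rewrite /cone_d0 /= !linearP /= scalerDr addrACA.
Qed.
HB.instance Definition _ :=
  GRing.isLinear.Build k _ _ _ cone_d0 cone_d0_linear.

Definition cone_dS p (x : X p.+1 * Y p.+2) : X p * Y p.+1 :=
  (- cd X p x.1, u p.+1 x.1 + cd Y p.+1 x.2).
Fact cone_dS_linear p : linear (@cone_dS p).
Proof.
move=> r x y; rewrite /cone_dS /= !linearP /=; congr (_, _).
by rewrite /= scalerDr addrACA.
Qed.
HB.instance Definition _ p :=
  GRing.isLinear.Build k _ _ _ (@cone_dS p) (@cone_dS_linear p).

Definition cone_d p : {linear cone p.+1 -> cone p} :=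
  match p return {linear cone p.+1 -> cone p} with
  | 0 => cone_d0
  | p'.+1 => @cone_dS p'
  end.

Lemma cone_dd p x : cone_d p (cone_d p.+1 x) = 0.
Proof.
case: p x => [|p] x /=.
  by rewrite /cone_d0 /= linearD cd_cd addr0 linearN /= cmap_cd addNr.
rewrite /cone_dS /= linearN cd_cd oppr0 oppr0 linearD cd_cd addr0 linearN /=.
by rewrite cmap_cd addNr.
Qed.

Definition cone_exact :=
  (forall x, exists y, x = cone_d 0 y) /\ forall p, exact_at (cone_d p.+1) (cone_d p).

Lemma cone_exact_qis : cone_exact -> qis u.
Proof.
move=> [ex0 ex]; split=> [p x y cx E|p y cy].
  (* The assumptions on x and y say that (x, -y) is a cycle of the cone. *)
  have [|w wE] := ex p ((x, - y) : cone p.+1).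
    case: p x y cx E => [|p] x y /= cx E.
      by rewrite /cone_d0 /= linearN E subrr.
    by rewrite /cone_dS /= linearN E cx subrr oppr0.
  case: w wE => x' y' /= [-> _]; exists (- x').
  by rewrite linearN.
case: p y cy => [|p] y cy.
  by have [[x y'] ->] := ex0 y; exists x, y'.
have [|[x y'] [E1 E2]] := ex p ((0, y) : cone p.+1).
  case: p y cy => [|p] y /= dy; first by rewrite /cone_d0 /= linear0 dy addr0.
  by rewrite /cone_dS /= !linear0 dy addr0.
exists x, y'; split=> //=.
by apply/eqP; rewrite -oppr_eq0 -E1.
Qed.

(** X and Y both resolve Z, compatibly with [u]; at the bottom the augmentations play the part of
    the missing differential. *)
Lemma cone_exact_aug (Z : lmodType k) (aX : {linear X 0 -> Z}) (aY : {linear Y 0 -> Z}) :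
  (forall x, aY (u 0%N x) = aX x) ->
  (forall z, exists x, z = aX x) ->
  (forall y, aY (cd Y 0 y) = 0) ->
  exact_at (cd X 0) aX -> exact_at (cd Y 0) aY ->
  (forall p, exact_at (cd X p.+1) (cd X p)) -> (forall p, exact_at (cd Y p.+1) (cd Y p)) ->
  cone_exact.
Proof.
move=> aE aS aYd eX0 eY0 eX eY; split.
  move=> /= y; have [x xE] := aS (aY y).
  have [|y' y'E] := eY0 (y - u 0%N x); first by rewrite linearB /= xE aE subrr.
  by exists (x, y'); rewrite /cone_d0 /= -y'E addrC subrK.
have solve p (x : X p) (y : Y p.+1) (x' : X p.+1) : x = cd X p x' ->
    u p x + cd Y p y = 0 -> exists w, (x, y) = cone_dS w :> X p * Y p.+1.
  move=> xE E; have [|y' y'E] := eY p (y + u p.+1 x').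
    by rewrite linearD /= -cmap_cd -xE addrC.
  by exists (- x', y'); rewrite /cone_dS /= !linearN opprK -xE -y'E addrC addrK.
case=> [|p] [x y] /=.
  rewrite /cone_d0 /= => E; have [|x' xE] := eX0 x; last exact: solve xE E.
  rewrite -aE; have /eqP := E; rewrite addr_eq0 => /eqP ->.
  by rewrite linearN aYd oppr0.
move=> [/eqP + E]; rewrite oppr_eq0 => /eqP dx; have [x' xE] := eX p x dx.
exact: solve xE E.
Qed.

End Cone.

Section ConeMap.
Variables (k : pzRingType) (X Y X' Y' : chain_complex k).
Variables (f : chain_map X X') (g : chain_map Y Y').

Definition cone_mapS p (x : X p * Y p.+1) : X' p * Y' p.+1 := (f p x.1, g p.+1 x.2).
Fact cone_mapS_linear p : linear (@cone_mapS p).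
Proof. by move=> r x y; rewrite /cone_mapS /= !linearP. Qed.
HB.instance Definition _ p :=
  GRing.isLinear.Build k _ _ _ (@cone_mapS p) (@cone_mapS_linear p).

Definition cone_map p : {linear cone X Y p -> cone X' Y' p} :=
  match p return {linear cone X Y p -> cone X' Y' p} with
  | 0 => g 0%N
  | p'.+1 => @cone_mapS p'
  end.

Lemma cone_map_d (u : chain_map X Y) (u' : chain_map X' Y') p x :
  (forall p x, g p (u p x) = u' p (f p x)) ->
  cone_d u' p (cone_map p.+1 x) = cone_map p (cone_d u p x).
Proof.
move=> E; case: p x => [|p] [x y] /=.
  by rewrite /cone_d0 /= linearD E cmap_cd.
by rewrite /cone_dS /cone_mapS /= linearD E linearN !cmap_cd.
Qed.
End ConeMap.

Lemma cone_map_exact (k : pzRingType) (X Y X' Y' X'' Y'' : chain_complex k)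
    (f : chain_map X X') (g : chain_map Y Y') (f' : chain_map X' X'') (g' : chain_map Y' Y'') p :
  (forall p, exact_at (f p) (f' p)) -> (forall p, exact_at (g p) (g' p)) ->
  exact_at (cone_map f g p) (cone_map f' g' p).
Proof.
move=> ef eg; case: p => [|p]; first exact: eg.
move=> [x y] E.
have [[a /= ->] [b /= ->]] := (ef _ _ (congr1 fst E), eg _ _ (congr1 snd E)).
by exists (a, b).
Qed.

(** * A double complex with exact rows and columns *)

Section DoubleComplex.
Variables (k : pzRingType) (X Y : nat -> chain_complex k) (X0 Y0 : chain_complex k).
Variables (u : forall q, chain_map (X q) (Y q)) (u0 : chain_map X0 Y0).
Variables (eX : forall q, chain_map (X q.+1) (X q)) (eY : forall q, chain_map (Y q.+1) (Y q)).
Variables (aX : chain_map (X 0) X0) (aY : chain_map (Y 0) Y0).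
Hypothesis ue : forall q p x, eY q p (u q.+1 p x) = u q p (eX q p x).
Hypothesis ua : forall p x, aY p (u 0 p x) = u0 p (aX p x).
Hypothesis eXX : forall q p x, eX q p (eX q.+1 p x) = 0.
Hypothesis eYY : forall q p x, eY q p (eY q.+1 p x) = 0.
Hypothesis aeX : forall p x, aX p (eX 0 p x) = 0.
Hypothesis aeY : forall p x, aY p (eY 0 p x) = 0.
Hypothesis exX : forall q p, exact_at (eX q.+1 p) (eX q p).
Hypothesis exY : forall q p, exact_at (eY q.+1 p) (eY q p).
Hypothesis exX0 : forall p, exact_at (eX 0 p) (aX p).
Hypothesis exY0 : forall p, exact_at (eY 0 p) (aY p).
Hypothesis aX_surj : forall p z, exists x, z = aX p x.
Hypothesis aY_surj : forall p z, exists x, z = aY p x.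
Hypothesis rows : forall q, cone_exact (u q).

Local Notation D p q := (cone (X q) (Y q) p).
Local Notation d p q := (cone_d (u q) p).
Local Notation e p q := (cone_map (eX q) (eY q) p).
Local Notation a p := (cone_map aX aY p).

Let ee p q x : e p q (e p q.+1 x) = 0.
Proof. by case: p x => [|p] x /=; rewrite ?eYY // /cone_mapS /= eXX eYY. Qed.

Let ae p x : a p (e p 0%N x) = 0.
Proof. by case: p x => [|p] x /=; rewrite ?aeY // /cone_mapS /= aeX aeY. Qed.

(** If d x = e y, then e (d y) = d (d x) = 0, so d y is in the image of e by exactness of the
    columns, and induction gives y = d w + e w'. Then d kills x - e w, and exactness of row q
    applies. *)
Lemma double_chase p q (x : D p q) :
  match p return D p q -> Prop with
  | 0 => fun=> True
  | p'.+1 => fun x => exists y, d p' q x = e p' q y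
  end x -> exists w w', x = d p q w + e p q w'.
Proof.
elim: p q x => [|p IH] q x.
  move=> _; have [w ->] := (rows q).1 x; exists w, 0.
  by rewrite linear0 addr0.
move=> [y yE].
have [|w [w' wE]] := IH q.+1 y.
  case: p {IH} x y yE => [//|p] x y yE.
  apply: (@cone_map_exact _ _ _ _ _ _ _ _ _ _ _ p (@exX q) (@exY q)).
  rewrite -(cone_map_d (u := u q.+1) (u' := u q)); last exact: ue.
  by rewrite -yE cone_dd.
have [|w'' w''E] := (rows q).2 p (x - e p.+1 q w).
  rewrite linearB /= (cone_map_d (u := u q.+1) (u' := u q)); last exact: ue.
  by rewrite yE wE linearD ee addr0 subrr.
by exists w'', w; rewrite -w''E subrK.
Qed.

(** Elements of the cone of [u0] lift to the row q = 0, where the chase applies; the augmentation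
    kills the part in the image of e. *)
Lemma double_complex_qis : qis u0.
Proof.
apply: cone_exact_qis.
have lift p (x : cone X0 Y0 p) : exists z, x = a p z.
  case: p x => [|p] x; first exact: aY_surj.
  case: x => x y; have [[x' ->] [y' ->]] := (aX_surj x, aY_surj y).
  by exists (x', y').
have final p (z : D p 0) w w' : z = d p 0 w + e p 0 w' ->
    a p z = cone_d u0 p (a p.+1 w).
  move=> ->; rewrite linearD ae addr0 (cone_map_d (u := u 0%N)) //; exact: ua.
split=> [x|p x dx].
  have [z ->] := lift 0%N x; have [//|w [w' /final E]] := @double_chase 0 0 z.
  by exists (a 1%N w); rewrite -E.
have [z zE] := lift p.+1 x; rewrite zE.
have [|w [w' /final E]] := @double_chase p.+1 0 z; last by exists (a p.+2 w); rewrite -E.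
apply: (@cone_map_exact _ _ _ _ _ _ _ _ _ _ _ p (@exX0) (@exY0)).
by rewrite -(cone_map_d (u := u 0%N) (u' := u0)) -?zE //; apply: ua.
Qed.

End DoubleComplex.

(** * The comparison of Tor *)

Section TensorComplexes.
Variables (k : comPzRingType) (C : category).

Lemma tens_mapr_mapr0 (A : modF k (op C)) (B B' B'' : modF k C)
    (f : modT B B') (g : modT B' B'') z :
  (forall x b, g x (f x b) = 0) -> tens_mapr A g (tens_mapr A f z) = 0.
Proof.
move=> E; apply: (@tensor_ext _ _ _ _ _ (tens_mapr A g \o tens_mapr A f) \0) => x a b /=.
rewrite !tens_maprE E.
by have := balZr (tens_balanced A B'') 0 a 0; rewrite !scale0r.
Qed.

Lemma tens_mapl_mapl0 (A A' A'' : modF k (op C)) (B : modF k C)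
    (f : modT A A') (g : modT A' A'') z :
  (forall x a, g x (f x a) = 0) -> tens_mapl B g (tens_mapl B f z) = 0.
Proof.
move=> E; apply: (@tensor_ext _ _ _ _ _ (tens_mapl B g \o tens_mapl B f) \0) => x a b /=.
rewrite !tens_maplE E.
by have := balZl (tens_balanced A'' B) 0 0 b; rewrite !scale0r.
Qed.

Lemma flat_inj (A : modF k (op C)) (B B' : modF k C) (f : modT B B') :
  flat A -> (forall x, injective (f x)) -> injective (tens_mapr A f).
Proof.
move=> fA fi z z' /eqP; rewrite -subr_eq0 -linearB => /eqP zz'.
apply/eqP; rewrite -subr_eq0; apply/eqP; move: (z - z') zz' => {z z'} z z0.
(* [o] is zero, so that injectivity of [f] becomes exactness of the pair [o], [f]. *)
pose o := modT_sub (modT_id B) (modT_id B).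
have [|y ->] := fA _ _ _ o f _ z z0.
  move=> x b b0; exists 0; rewrite linear0; apply: (fi x).
  by rewrite b0 linear0.
rewrite -[RHS](@tens_mapr_mapr0 A _ _ _ (modT_id B) o y) => [|x b].
  by congr (tens_mapr _ _ _); apply/esym/(@tensor_ext _ _ _ _ _ (tens_mapr A (modT_id B)) idfun) => x a b; rewrite tens_maprE.
by rewrite /= subrr.
Qed.

Lemma tens_union (A : modF k (op C)) (B : modF k C) (Bn : nat -> modF k C)
    (v : forall N, modT (Bn N) B) :
  (forall x b, exists N, forall N', (N <= N')%N -> exists b', v N' x b' = b) ->
  forall z, exists N, forall N', (N <= N')%N -> exists z', tens_mapr A (v N') z' = z.
Proof.
move=> h; apply: tensor_ind => [|p q [N hp] [M hq]|x a b].
- by exists 0%N => N' _; exists 0; rewrite linear0.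
- exists (maxn N M) => N'; rewrite geq_max => /andP[/hp[p' <-] /hq[q' <-]].
  by exists (p' + q'); rewrite linearD.
- have [N hN] := h x b; exists N => N' /hN[b' <-].
  by exists (tens a b'); rewrite tens_maprE.
Qed.

Section MapComplex.
Variables (A : nat -> modF k (op C)) (d : forall n, modT (A n.+1) (A n)).
Hypothesis dd : forall n x a, d n x (d n.+1 x a) = 0.

Definition tens_complex (B : modF k C) : chain_complex k :=
  @ChainComplex k (fun n => tensor (A n) B) (fun n => tens_mapl B (d n))
    (fun n z => tens_mapl_mapl0 z (@dd n)).

Definition tens_complex_map (B B' : modF k C) (f : modT B B') :
    chain_map (tens_complex B) (tens_complex B') :=
  @ChainMap k (tens_complex B) (tens_complex B') (fun n => tens_mapr (A n) f)
    (fun n z => esym (tens_mapl_mapr (d n) f z)).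
End MapComplex.
End TensorComplexes.

(** * The comparison when alternating sums vanish uniformly on F *)

Section SmallCase.
Variables (k : comPzRingType) (F : modF k (op gr)) (N : nat).
Hypothesis smallF : forall n (x : F n), small_elt N.+1 x.
Variable G : modF k gr.
Variables (P : resolution (pull (opF beta) G)) (Q : resolution G) (u : res_lift P Q).
Local Notation B := (pull beta F).

Lemma small_qis : qis (tens_res_pull F u).
Proof.
have [W] := resolution_exists B.
pose R n := pull (opF beta) (Q n : modF k (op (op gr))).
pose dR n : modT (R n.+1) (R n) := pullT (opF beta) (res_d Q n : @modT k (op (op gr)) _ _).
pose eR : modT (R 0%N) (pull (opF beta) G) := pullT (opF beta) (res_e Q : @modT k (op (op gr)) _ _).
have dPP n x p : res_d P n x (res_d P n.+1 x p) = 0 by apply: res_dd.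
have dRR n x p : dR n x (dR n.+1 x p) = 0 by apply: (res_dd (R := Q)).
pose X := tens_complex dPP; pose Y := tens_complex dRR.
have u_nat V p (z : X V p.+1) :
    tens_mapl V (u p) (tens_mapl V (res_d P p) z) =
    tens_mapl V (dR p) (tens_mapl V (u p.+1) z).
  have E : forall x a, modT_comp (dR p) (u p.+1) x a = u p x (res_d P p x a).
    by move=> x a; rewrite rlift_d.
  by rewrite (tens_mapl_comp (h := modT_comp (dR p) (u p.+1))) // (tens_mapl_comp (h := modT_comp (dR p) (u p.+1))).
pose uV V : chain_map (X V) (Y V) :=
  @ChainMap k (X V) (Y V) (fun n => tens_mapl V (u n)) (u_nat V).
have acR p := acyclic_projective smallF W (@res_proj _ _ _ Q p).
have flP p : flat (P p) := projective_flat (@res_proj _ _ _ P p).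
(* Here p is the degree in P and Q, and q the degree in W. The columns are exact by flatness of P p,
   and by acyclicity of the pullback of Q p together with right exactness at the augmentation. *)
have qisB : qis (uV B).
  apply: (double_complex_qis (u := fun q => uV (W q))
    (eX := fun q => tens_complex_map dPP (res_d W q))
    (eY := fun q => tens_complex_map dRR (res_d W q))
    (aX := tens_complex_map dPP (res_e W)) (aY := tens_complex_map dRR (res_e W))).
  - by move=> q p x; rewrite /= tens_mapl_mapr.
  - by move=> p x; rewrite /= tens_mapl_mapr.
  - by move=> q p x; apply: tens_mapr_mapr0 => n b; apply: res_dd.
  - by move=> q p x; apply: tens_mapr_mapr0 => n b; apply: res_dd.
  - by move=> p x; apply: tens_mapr_mapr0 => n b; apply/res_exact0; exists b.
  - by move=> p x; apply: tens_mapr_mapr0 => n b; apply/res_exact0; exists b.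
  - by move=> q p; apply: flP => n b /res_exact.
  - by move=> q p; apply: (acR p).1.
  - by move=> p; apply: flP => n b /res_exact0.
  - by move=> p; apply: tens_mapr_right_exact; [apply: res_exact0|apply: res_surj].
  - by move=> p; apply: tens_mapr_surj; apply: res_surj.
  - by move=> p; apply: tens_mapr_surj; apply: res_surj.
  (* Tensoring with the flat functor W q keeps P and the pullback of Q exact over the pullback of
     G. *)
  move=> q; have pW := @res_proj _ _ _ W q.
  apply: (@cone_exact_aug k (X (W q)) (Y (W q)) (uV (W q)) (tensor (pull (opF beta) G) (W q))
    (tens_mapl (W q) (res_e P)) (tens_mapl (W q) eR)).
  - by move=> z; apply: tens_mapl_comp => x a; rewrite -(rlift_e u).
  - by apply: tens_mapl_surj; apply: res_surj.
  - move=> z; apply: tens_mapl_mapl0 => x a.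
    by apply: (proj2 (@res_exact0 _ _ _ Q x _)); exists a.
  - by apply: projective_flat_r => // x a /res_exact0.
  - apply: projective_flat_r => // x a a0.
    exact: (proj1 (@res_exact0 _ _ _ Q x a) a0).
  - by move=> p; apply: projective_flat_r => // x a /res_exact.
  - move=> p; apply: projective_flat_r => // x a a0.
    exact: (proj1 (@res_exact _ _ _ Q p x a) a0).
(* It remains to pass from the pullback of Q over S_c(gr) to Q over gr. [tens_pull] is onto as
   [beta] is the identity on objects, and injective by acyclicity. *)
have pull_surj p z : exists y, tens_pull beta (Q p : modF k (op (op gr))) F y = z.
  elim/tensor_ind: z => [|y z [y' <-] [z' <-]|n a b].
  - by exists 0; rewrite linear0.
  - by exists (y' + z'); rewrite linearD.
  - by exists (@tens k Sc_gr (R p) B n a b); apply: tens_liftE.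
have pull_nat p y : tens_pull beta (Q p : modF k (op (op gr))) F (tens_mapl B (dR p) y) =
    @tens_mapl k (op gr) _ _ F (res_d Q p) (tens_pull beta (Q p.+1 : modF k (op (op gr))) F y).
  apply: (@tensor_ext _ _ _ _ _ (tens_pull beta (Q p : modF k (op (op gr))) F \o tens_mapl B (dR p))
    (@tens_mapl k (op gr) _ _ F (res_d Q p) \o tens_pull beta (Q p.+1 : modF k (op (op gr))) F)) => n a b.
  rewrite /= tens_maplE; apply: etrans (tens_liftE _ _ _) _.
  rewrite tens_liftE; exact: esym (tens_maplE _ _ _).
case: qisB => qi qs; split=> [p x y cx E|p y cy].
  have [y' y'E] := pull_surj p.+1 y.
  apply: (qi p x y' cx); apply: (acR p).2.
  apply: etrans E _; apply: etrans _ (esym (pull_nat p y')).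
  exact: congr1 (esym y'E).
have [y' y'E] := pull_surj p y.
have [|x [w [cx yE]]] := qs p y'.
  case: p y cy y' y'E => [//|p] y dy y' y'E.
  apply: (acR p).2; apply: etrans (pull_nat p y') _; rewrite y'E linear0.
  exact: dy.
exists x, (tens_pull beta (Q p.+1 : modF k (op (op gr))) F w); split=> //.
rewrite -y'E yE linearD; congr (_ + _); exact: pull_nat.
Qed.
End SmallCase.

Section AnalyticCase.
Variables (k : comPzRingType) (F : modF k (op gr)) (G : modF k gr).
Variables (P : resolution (pull (opF beta) G)) (Q : resolution G) (u : res_lift P Q).

(** F is the increasing union of the subfunctors [smallF F N], to which [small_qis] applies. As the
    terms of P and Q are flat, the complexes of these subfunctors embed in those of F and exhaust
    them. *)
Lemma analytic_qis : analytic F -> qis (tens_res_pull F u).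
Proof.
move=> anF.
pose v N := smallF_val F N.
have v_union n (x : F n) : exists N, forall N', (N <= N')%N -> exists y, v N' n y = x.
  have [N sx] := analytic_small x anF; exists N => N' le.
  exact: smallF_valP (small_le le sx).
have iN_nat N n z : tens_mapr (P n) (pullT beta (v N)) (tens_mapl _ (res_d P n) z) =
    tens_mapl _ (res_d P n) (tens_mapr (P n.+1) (pullT beta (v N)) z).
  by rewrite tens_mapl_mapr.
pose iN N : chain_map (tens_res_l (pull beta (smallF F N)) P) (tens_res_l (pull beta F) P) :=
  @ChainMap k (tens_res_l (pull beta (smallF F N)) P) (tens_res_l (pull beta F) P)
    (fun n => tens_mapr (P n) (pullT beta (v N))) (iN_nat N).
have jN_nat N n z : @tens_mapr k (op gr) (Q n) _ _ (v N) (@tens_mapl k (op gr) _ _ _ (res_d Q n) z) =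
    @tens_mapl k (op gr) _ _ _ (res_d Q n) (@tens_mapr k (op gr) (Q n.+1) _ _ (v N) z).
  by rewrite tens_mapl_mapr.
pose jN N : chain_map (@tens_res_l k (op gr) G (smallF F N) Q) (@tens_res_l k (op gr) G F Q) :=
  @ChainMap k (@tens_res_l k (op gr) G (smallF F N) Q) (@tens_res_l k (op gr) G F Q)
    (fun n => @tens_mapr k (op gr) (Q n) _ _ (v N)) (jN_nat N).
apply: (qis_union (fn := fun N => tens_res_pull (smallF F N) u) (i := iN) (j := jN)).
- move=> N p.
  apply: (@tensor_ext _ _ _ _ _
    ((tens_res_pull F u p : {linear tensor (P p) (pull beta F) -> @tensor k (op gr) (Q p) F}) \o tens_mapr (P p) (pullT beta (v N)))
    (@tens_mapr k (op gr) (Q p) _ _ (v N) \o (tens_res_pull (smallF F N) u p : {linear tensor (P p) (pull beta (smallF F N)) -> @tensor k (op gr) (Q p) (smallF F N)}))) => n a b.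
  rewrite /= tens_maprE !tens_maplE !tens_liftE.
  by [].
- move=> N p; apply: flat_inj; first exact/projective_flat/res_proj.
  by move=> n; apply: smallF_val_inj.
- move=> N p; apply: flat_inj; first exact/projective_flat/res_proj.
  by move=> n; apply: smallF_val_inj.
- by move=> p; apply: tens_union => n b; apply: v_union.
- by move=> p; apply: tens_union => n b; apply: v_union.
(* The bound is raised from N to N + 1, since [small_qis] works with at least one copy. *)
- move=> N; apply: (@small_qis k (smallF F N) N) => n x.
  exact: small_le (leqnSn N) (smallF_small x).
Qed.
End AnalyticCase.

Lemma swap_qis (k : comPzRingType) (C : category) (A : modF k (op C)) (B : modF k C)
    (P : resolution A) : qis (tens_res_swap B P).
Proof.
apply: iso_qis => n.
  exact: can_inj (@tens_swapK k C (P n) B).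
move=> y; exists (@tens_swap k (op C) B (P n) y).
exact: (@tens_swapK k (op C) B (P n) y).
Qed.

Theorem mainTheorem5 (k : comPzRingType) (F : modF k (op gr)) (hF : analytic F)
    (G : modF k gr)
    (P : resolution (pull (opF beta) G)) (Q : resolution G) (u : res_lift P Q)
    (n : nat) :
  bijective (Tor_beta F u n).
Proof.
apply: bij_comp; apply: qis_homology; first exact: swap_qis.
exact: analytic_qis.
Qed.
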